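(* Let $A$ be a definite quaternion algebra over $\mathbb{Q}$ with reduced discriminant $D_A$, and let $\mathcal{O}$ be a maximal order of $A$. The following properties are equivalent: (1) the different of $\mathcal{O}$ is principal; (2) $\mathcal{O}$ contains an element of reduced norm $D_A$; (3) $\mathcal{O}$ contains an element of square $-D_A$; (4) the euclidean $\mathbb{Z}$-lattice $L(\mathcal{O})$ contains an element $x$ such that $x\cdot x=2D_A$ and $x\cdot y\equiv 0 \bmod D_A$ for all $y\in L(\mathcal{O})$; (5) the euclidean $\mathbb{Z}$-lattice $M(\mathcal{O})$ contains an element $x$ such that $x\cdot x=2$.
   Context: $A$ definite means that $A\otimes_{\mathbb{Q}}\mathbb{R}$ is Hamilton's quaternion algebra. Write $x\mapsto\overline{x}$ and $\mathtt{tr}$ for the conjugation and reduced trace. The reduced discriminant $D_A$ is the product of the primes at which $A$ ramifies. The different of $\mathcal{O}$ is the unique right ideal of $\mathcal{O}$ of reduced norm $D_A$ (i.e. of index $D_A^2$); it is two-sided; it is principal if it is of the form $\pi\mathcal{O}$ with $\pi\in\mathcal{O}$. $L(\mathcal{O})=\{x\in\mathcal{O}:\mathtt{tr}(x)=0\}$ is endowed with the scalar product $x\cdot y=\mathtt{tr}(\overline{x}\,y)$; it is a rank $3$ even integral lattice in the euclidean space $E=L(\mathcal{O})\otimes_{\mathbb{Z}}\mathbb{R}$. For a lattice $L$ in a euclidean space $E$, $L^\sharp=\{x\in E: x\cdot y\in\mathbb{Z}\ \forall y\in L\}$ is its dual. For an even integral lattice $L$ and an integer $d\ge1$, put $$\Lambda(L;d)=\{x\in(d^{-1}L)\cap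 L^\sharp\ :\ d\,(x\cdot x)\equiv0 \bmod 2\},\qquad \mathrm{M}(L;d)=\sqrt{d}\,\Lambda(L;d)\subset E.$$ Finally $M(\mathcal{O})=\mathrm{M}(L(\mathcal{O});D_A)$. *)

(* Defs.v *)
From HB Require Import structures.
From mathcomp Require Import all_boot all_order all_algebra.
From mathcomp Require Import boolp classical_sets cardinality fsbigop reals.
From mathcomp Require Import ring.

Set Implicit Arguments.
Unset Strict Implicit.
Unset Printing Implicit Defensive.

Import Order.TTheory GRing.Theory Num.Theory.

Local Open Scope classical_set_scope.
Local Open Scope card_scope.
Local Open Scope ring_scope.

(* [quat a b] is the quaternion algebra (a, b | K), with basis 1, i, j, k = ij *)
(* and relations i^2 = a, j^2 = b, ij = - ji; [Quat x y z t] stands for        *)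
(* x + y i + z j + t k. Every quaternion algebra over a field K of              *)
(* characteristic other than 2 has this form, with a and b nonzero.            *)
Record quat (K : Type) (a b : K) :=
  Quat { quat0 : K; quat1 : K; quat2 : K; quat3 : K }.
Arguments Quat {K a b}.

Section QuatChoice.
Variables (K : choiceType) (a b : K).

Definition tuple_of_quat (x : quat a b) : K * K * K * K :=
  (quat0 x, quat1 x, quat2 x, quat3 x).
Definition quat_of_tuple (x : K * K * K * K) : quat a b :=
  Quat x.1.1.1 x.1.1.2 x.1.2 x.2.
Lemma tuple_of_quatK : cancel tuple_of_quat quat_of_tuple.
Proof. by case. Qed.
HB.instance Definition _ := Choice.copy (quat a b) (can_type tuple_of_quatK).
End QuatChoice.

Section QuatRing.
Variables (K : comNzRingType) (a b : K).
Local Notation A := (quat a b).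
Implicit Types x y z : A.

Definition quat_add x y : A :=
  Quat (quat0 x + quat0 y) (quat1 x + quat1 y)
       (quat2 x + quat2 y) (quat3 x + quat3 y).
Definition quat_opp x : A :=
  Quat (- quat0 x) (- quat1 x) (- quat2 x) (- quat3 x).
Definition quat_mul x y : A :=
  let: Quat x0 x1 x2 x3 := x in let: Quat y0 y1 y2 y3 := y in
  Quat (x0 * y0 + a * (x1 * y1) + b * (x2 * y2) - a * b * (x3 * y3))
       (x0 * y1 + x1 * y0 - b * (x2 * y3) + b * (x3 * y2))
       (x0 * y2 + x2 * y0 + a * (x1 * y3) - a * (x3 * y1))
       (x0 * y3 + x3 * y0 + x1 * y2 - x2 * y1).
Definition quat_scale (c : K) x : A :=
  Quat (c * quat0 x) (c * quat1 x) (c * quat2 x) (c * quat3 x).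

Fact quat_addA : associative quat_add.
Proof. by move=> [????] [????] [????]; congr Quat => /=; ring. Qed.
Fact quat_addC : commutative quat_add.
Proof. by move=> [????] [????]; congr Quat => /=; ring. Qed.
Fact quat_add0 : left_id (Quat 0 0 0 0) quat_add.
Proof. by move=> [????]; congr Quat => /=; ring. Qed.
Fact quat_addN : left_inverse (Quat 0 0 0 0) quat_opp quat_add.
Proof. by move=> [????]; congr Quat => /=; ring. Qed.
HB.instance Definition _ :=
  GRing.isZmodule.Build A quat_addA quat_addC quat_add0 quat_addN.

Fact quat_mulA : associative quat_mul.
Proof. by move=> [????] [????] [????]; congr Quat => /=; ring. Qed.
Fact quat_mul1l : left_id (Quat 1 0 0 0) quat_mul.
Proof. by move=> [????]; congr Quat => /=; ring. Qed.
Fact quat_mul1r : right_id (Quat 1 0 0 0) quat_mul.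
Proof. by move=> [????]; congr Quat => /=; ring. Qed.
Fact quat_mulDl : left_distributive quat_mul +%R.
Proof. by move=> [????] [????] [????]; congr Quat => /=; ring. Qed.
Fact quat_mulDr : right_distributive quat_mul +%R.
Proof. by move=> [????] [????] [????]; congr Quat => /=; ring. Qed.
Fact quat_oner_neq0 : Quat 1 0 0 0 != 0 :> A.
Proof. by apply/eqP => -[] /eqP; rewrite oner_eq0. Qed.
HB.instance Definition _ := GRing.Zmodule_isNzRing.Build A
  quat_mulA quat_mul1l quat_mul1r quat_mulDl quat_mulDr quat_oner_neq0.

Fact quat_scaleA c d x : quat_scale c (quat_scale d x) = quat_scale (c * d) x.
Proof. by case: x => ????; congr Quat => /=; ring. Qed.
Fact quat_scale1 : left_id 1 quat_scale.
Proof. by move=> [????]; congr Quat => /=; ring. Qed.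
Fact quat_scaleDr : right_distributive quat_scale +%R.
Proof. by move=> ? [????] [????]; congr Quat => /=; ring. Qed.
Fact quat_scaleDl x : {morph quat_scale^~ x : c d / c + d}.
Proof. by case: x => ???? ? ?; congr Quat => /=; ring. Qed.
HB.instance Definition _ := GRing.Zmodule_isLmodule.Build K A
  quat_scaleA quat_scale1 quat_scaleDr quat_scaleDl.

Fact quat_scaleAl (c : K) x y : c *: (x * y) = (c *: x) * y.
Proof. by case: x => ????; case: y => ????; congr Quat => /=; ring. Qed.
HB.instance Definition _ := GRing.Lmodule_isLalgebra.Build K A quat_scaleAl.
Fact quat_scaleAr (c : K) x y : c *: (x * y) = x * (c *: y).
Proof. by case: x => ????; case: y => ????; congr Quat => /=; ring. Qed.
HB.instance Definition _ := GRing.Lalgebra_isAlgebra.Build K A quat_scaleAr.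

Definition quat_conj x : A := Quat (quat0 x) (- quat1 x) (- quat2 x) (- quat3 x).

Definition quat_trace x : K := quat0 x *+ 2.

Definition quat_norm x : K :=
  quat0 x ^+ 2 - a * quat1 x ^+ 2 - b * quat2 x ^+ 2 + a * b * quat3 x ^+ 2.

Definition quat_dot x y : K := quat_trace (quat_conj x * y).

Lemma quat_conjM x y : quat_conj (x * y) = quat_conj y * quat_conj x.
Proof. by case: x => ????; case: y => ????; congr Quat => /=; ring. Qed.

Lemma quat_traceE x : x + quat_conj x = (quat_trace x)%:A.
Proof. by case: x => ????; congr Quat; rewrite /quat_trace /=; ring. Qed.

Lemma quat_normE x : x * quat_conj x = (quat_norm x)%:A.
Proof. by case: x => ????; congr Quat; rewrite /quat_norm /=; ring. Qed.

End QuatRing.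

Section BaseChange.
Variables (a b : rat) (K : fieldType).

(* (a, b | Q) (x)_Q K, for a field K of characteristic 0. *)
Definition quat_over := quat (ratr a : K) (ratr b : K).

Definition quat_incl (x : quat a b) : quat_over :=
  Quat (ratr (quat0 x)) (ratr (quat1 x)) (ratr (quat2 x)) (ratr (quat3 x)).
End BaseChange.

(* Hamilton's quaternions are (-1, -1 | R). *)
Definition definite (R : realType) (a b : rat) : Prop :=
  exists f : {lrmorphism quat (ratr a : R) (ratr b : R) ->
                         quat (-1 : R) (-1 : R)}, bijective f.

(* Z_p as the inverse limit of the Z / p^n Z, whose elements are represented  *)
(* by their least nonnegative residue: the condition says both that           *)
(* 0 <= x n < p^n and that x n.+1 reduces to x n.                             *)
Record padic_int (p : nat) (p_pr : prime p) := PadicInt {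
  padic_res :> nat -> int;
  _ : `[< forall n, padic_res n = (padic_res n.+1 %% (p ^ n)%N)%Z >] }.

Section PadicInt.
Variables (p : nat) (p_pr : prime p).
Local Notation padic_int := (padic_int p_pr).

HB.instance Definition _ := [isSub for @padic_res p p_pr].
HB.instance Definition _ := [Choice of padic_int by <:].

Implicit Types (x y z : padic_int) (f g : nat -> int).

Local Notation pn n := (Posz (p ^ n)).

Lemma padic_resS x n : x n = (x n.+1 %% pn n)%Z.
Proof. by case: x => f /= /asboolP. Qed.

Lemma padic_resK x n : (x n %% pn n)%Z = x n.
Proof. by rewrite [in LHS]padic_resS modz_mod -padic_resS. Qed.

Lemma padic_intP x y : (forall n, x n = y n) -> x = y.
Proof. by move=> exy; apply: val_inj; apply: funext. Qed.

Fact padic_mk_subproof f :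
    (forall n, (f n.+1 = f n %[mod pn n])%Z) ->
  `[< forall n, (f n %% pn n)%Z = ((f n.+1 %% pn n.+1)%Z %% pn n)%Z >].
Proof.
move=> f_coh; apply/asboolP => n; rewrite -f_coh.
rewrite {1}(intdiv.divz_eq (f n.+1) (pn n.+1)) expnS PoszM.
by rewrite mulrA modzMDl.
Qed.

Definition padic_mk f (f_coh : forall n, (f n.+1 = f n %[mod pn n])%Z) :=
  PadicInt p_pr (padic_mk_subproof f_coh).

Lemma padic_coh x n : (x n.+1 = x n %[mod pn n])%Z.
Proof. by rewrite padic_resK -padic_resS. Qed.

Fact padic_const_coh (c : int) (n : nat) : (c = c %[mod pn n])%Z.
Proof. by []. Qed.
Fact padic_add_coh x y n : (x n.+1 + y n.+1 = x n + y n %[mod pn n])%Z.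
Proof. by rewrite -modzDm !padic_coh modzDm. Qed.
Fact padic_opp_coh x n : (- x n.+1 = - x n %[mod pn n])%Z.
Proof. by rewrite -modzNm padic_coh modzNm. Qed.
Fact padic_mul_coh x y n : (x n.+1 * y n.+1 = x n * y n %[mod pn n])%Z.
Proof. by rewrite -modzMm !padic_coh modzMm. Qed.

Definition padic_const c := padic_mk (padic_const_coh c).
Definition padic_add x y := padic_mk (padic_add_coh x y).
Definition padic_opp x := padic_mk (padic_opp_coh x).
Definition padic_mul x y := padic_mk (padic_mul_coh x y).

Fact padic_addA : associative padic_add.
Proof. by move=> x y z; apply: padic_intP => n /=; rewrite modzDml modzDmr addrA. Qed.
Fact padic_addC : commutative padic_add.
Proof. by move=> x y; apply: padic_intP => n /=; rewrite addrC. Qed.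
Fact padic_add0 : left_id (padic_const 0) padic_add.
Proof. by move=> x; apply: padic_intP => n /=; rewrite modzDml add0r padic_resK. Qed.
Fact padic_addN : left_inverse (padic_const 0) padic_opp padic_add.
Proof. by move=> x; apply: padic_intP => n /=; rewrite modzDml addNr. Qed.
HB.instance Definition _ :=
  GRing.isZmodule.Build padic_int padic_addA padic_addC padic_add0 padic_addN.

Fact padic_mulA : associative padic_mul.
Proof. by move=> x y z; apply: padic_intP => n /=; rewrite modzMml modzMmr mulrA. Qed.
Fact padic_mulC : commutative padic_mul.
Proof. by move=> x y; apply: padic_intP => n /=; rewrite mulrC. Qed.
Fact padic_mul1 : left_id (padic_const 1) padic_mul.
Proof. by move=> x; apply: padic_intP => n /=; rewrite modzMml mul1r padic_resK. Qed.
Fact padic_mulDl : left_distributive padic_mul +%R.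
Proof.
by move=> x y z; apply: padic_intP => n /=; rewrite modzMml modzDm mulrDl.
Qed.
Fact padic_oner_neq0 : padic_const 1 != 0.
Proof.
apply/eqP => /(congr1 (fun x : padic_int => x 1%N)) /=.
by rewrite expn1 mod0z modz_small // ltz_nat prime_gt1.
Qed.
HB.instance Definition _ := GRing.Zmodule_isComNzRing.Build padic_int
  padic_mulA padic_mulC padic_mul1 padic_mulDl padic_oner_neq0.

Definition padic_unit : {pred padic_int} :=
  fun x => `[< exists y, y * x = 1 >].
Definition padic_inv x : padic_int :=
  if pselect (exists y, y * x = 1) is left ex then projT1 (cid ex) else x.

Fact padic_mulVx : {in padic_unit, left_inverse 1 padic_inv *%R}.
Proof.
move=> x /asboolP xU; rewrite /padic_inv; case: pselect => // ex.
by case: (cid ex).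
Qed.
Fact padic_unitPl x y : y * x = 1 -> padic_unit x.
Proof. by move=> yx1; apply/asboolP; exists y. Qed.
Fact padic_inv_out : {in [predC padic_unit], padic_inv =1 id}.
Proof.
move=> x /negP xNU; rewrite /padic_inv; case: pselect => // ex.
by case: xNU; apply/asboolP.
Qed.
HB.instance Definition _ := GRing.ComNzRing_hasMulInverse.Build padic_int
  padic_mulVx padic_unitPl padic_inv_out.

Lemma padic_neq0 x : x != 0 ->
  exists m, forall n, ~~ (pn m %| x (m + n)%N)%Z.
Proof.
move=> x0; have [m xm0] : exists m, x m != 0.
  apply: contrapT => xN; case/eqP: x0; apply: padic_intP => n /=.
  by rewrite mod0z; apply/eqP; apply: contrapT => /negP xn; apply: xN; exists n.
exists m => n; suff /eqP e : x (m + n)%N == x m %[mod pn m]%Z.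
  by apply/dvdz_mod0P; rewrite e padic_resK; apply/eqP.
elim: n => [|n IHn]; first by rewrite addn0.
rewrite addnS -(eqP IHn) eqz_mod_dvd.
apply: (@dvdz_trans (pn (m + n))); last by rewrite -eqz_mod_dvd padic_coh.
by rewrite expnD PoszM dvdz_mulr.
Qed.

Fact padic_integral : GRing.integral_domain_axiom padic_int.
Proof.
move=> x y xy0; apply/norP => -[/padic_neq0 [m xm] /padic_neq0 [k yk]].
have := congr1 (fun x : padic_int => x (m + k)%N) xy0.
rewrite /= mod0z => /dvdz_mod0P.
move: (xm k) (yk m); rewrite (addnC k m) !dvdzE /= abszM.
set u := `|_|%N; set v := `|_|%N => um vk.
have u0 : (0 < u)%N by case: posnP um => // ->; rewrite dvdn0.
have v0 : (0 < v)%N by case: posnP vk => // ->; rewrite dvdn0.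
move: um vk; rewrite !pfactor_dvdn ?muln_gt0 ?u0 // lognM // -!ltnNge => um vk.
by rewrite leqNgt -addnS; case/negP; rewrite leq_add // ltnW.
Qed.
HB.instance Definition _ :=
  GRing.ComUnitRing_isIntegral.Build padic_int padic_integral.

Definition padic := {fraction padic_int}.

End PadicInt.

(* A (x) Q_p is a division algebra. *)
Definition ramified (a b : rat) (p : nat) : Prop :=
  exists p_pr : prime p,
    forall x : quat_over a b (padic p_pr), x != 0 ->
      exists y, x * y = 1 /\ y * x = 1.

(* Only finitely many primes are ramified when a and b are nonzero, so that    *)
(* this is never the default value of a product over an infinite set.          *)
Definition reduced_disc (a b : rat) : nat :=
  (\big[muln/1%N]_(p \in [set p : nat | ramified a b p]) p)%N.

Section Orders.
Variables a b : rat.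
Local Notation A := (quat a b).
Local Notation D := (reduced_disc a b).
Implicit Types O I : set A.

Definition is_order O : Prop :=
  [/\ subring_closed (mem O),
      exists n (s : n.-tuple A), O = [set x | inIntSpan s x] &
      forall x : A, exists m : nat, (0 < m)%N /\ O (x *+ m)].

Definition is_maximal_order O : Prop :=
  is_order O /\ forall O', is_order O' -> O `<=` O' -> O' = O.

Definition right_ideal O I : Prop :=
  [/\ I `<=` O, zmod_closed (mem I) &
      forall x y, I x -> O y -> I (x * y)].

Definition cosets O I : set (set A) := [set [set x + y | y in I] | x in O].

(* The right ideal of reduced norm D is the one of index D ^ 2; [unique] makes  *)
(* [is_different O I] a definite description, "I is the right ideal such that". *)
Definition is_different O : set A -> Prop :=
  unique (fun I => right_ideal O I /\ cosets O I #= `I_(D ^ 2)%N).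

Definition principal_right O I : Prop :=
  exists2 pi, O pi & I = [set pi * x | x in O].

Definition trace0 O : set A := [set x | O x /\ quat_trace x = 0].
End Orders.

Section Lattices.
Variables (R : realType) (V : lmodType R).
(* A euclidean space, given as a subspace E of V with the scalar product dot. *)
Variables (E : set V) (dot : V -> V -> R).

Definition dual_lattice (L : set V) : set V :=
  [set x | E x /\ forall y, L y -> dot x y \is a Num.int].

Definition Lambda_lattice (L : set V) (d : nat) : set V :=
  [set x | [/\ L (d%:R *: x), dual_lattice L x &
               d%:R * dot x x / 2 \is a Num.int]].

Definition M_lattice (L : set V) (d : nat) : set V :=
  [set Num.sqrt (d%:R : R) *: x | x in Lambda_lattice L d].
End Lattices.

(* The ambient space L(O) (x) R is the space of trace 0 elements of A (x) R. *)
Definition M_order (R : realType) (a b : rat) (O : set (quat a b)) :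
    set (quat_over a b R) :=
  M_lattice [set x : quat_over a b R | quat_trace x = 0] (@quat_dot R _ _)
    (@quat_incl a b R @` trace0 O) (reduced_disc a b).
Arguments M_order R {a b} O.

(* Main.v *)
Require Import Defs.
From mathcomp Require Import all_boot all_order all_algebra.
From mathcomp Require Import boolp classical_sets cardinality fsbigop reals.
From mathcomp Require Import ring lra zify.

(** Write [N] and [tr] for the reduced norm and trace. For a prime [p], let [J]
    be the radical of the norm form modulo [p], i.e. the [x] in [O] such that
    [p] divides [N x] and all [tr (x y)]. If [x] lies in [J] and [p ^ 2] divides
    [N x], then [O + O (x / p)] is an order, so [x] lies in [p O]. It follows that
    either [J = p O], or [J] is the set of all [x] in [O] with [p] dividing [N x],
    of index [p ^ 2]. In the first case the norm form modulo [p] has an isotropic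
    vector, which lifts to a zero over [Q_p] by Hensel's lemma, so [p] is
    unramified; in the second case [p ^ 2] never divides [N x] outside [p O], so
    [p] is ramified. Hence [P = {x in O : D | N x}] has index [D ^ 2], it is the
    only right ideal of that index, and every [w] in [O] of norm [D] generates it.

    If [N x = D], then [D] divides [t = tr x] and [t ^ 2 <= 4 D], so that [t = 0]
    or [D <= 3]. For [D = 3], [2 x - t] is a square root of [- D]. For [D <= 2],
    Hermite reduction yields a nonzero [y] of trace [0] in the dual of [O], which is
    contained in [P / D], with [27 N y <= 16]: this excludes [D = 1], and for
    [D = 2] it makes [2 y] a square root of [- D]. *)

Set Implicit Arguments.
Unset Strict Implicit.
Unset Printing Implicit Defensive.

Import Order.TTheory GRing.Theory Num.Theory.
Local Open Scope classical_set_scope.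
Local Open Scope card_scope.
Local Open Scope ring_scope.

(** * Arithmetic preliminaries and quaternion identities *)

(** The local study takes place inside [O], through divisibility of norms and traces: [O] is never
    completed, quaternion algebras over [Q_p] are not classified, and [Q_p] appears only where the
    definition of ramification requires it. All counts rest on the fact that [p O] has index
    [p ^ 4]. The norm is part of the definition of the radical because the trace form yields only
    [2 N x], which says nothing at [p = 2]; this prime causes most of the separate arguments. From
    norm [D] to a square root of [- D], the obstacle is a nonzero trace. It does occur for [D = 2]:
    in the Hurwitz order [1 + i] has norm 2, but [2 x - t] is then [2 i], a square root of [- 4], so
    another element has to be found. That [D] is not 1 is usually drawn from Hilbert reciprocity;
    here one short vector of the dual of [O] settles both cases. Its bound [16 / 27] comes from two
    binary reductions and from the lower bound 3 for positive values of [4 N x - (tr x) ^ 2]; any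
    bound below 1 would do. *)

Ltac quat_ring :=
  repeat match goal with |- context [?x] =>
    is_var x; let T := type of x in
    let T := eval hnf in T in
    lazymatch T with quat _ _ => generalize x; intros [? ? ? ?] end end;
  rewrite ?/quat_dot ?/quat_trace ?/quat_norm;
  (try congr Quat) => /=; ring.

Ltac quat_field :=
  repeat match goal with |- context [?x] =>
    is_var x; let T := type of x in
    let T := eval hnf in T in
    lazymatch T with quat _ _ => generalize x; intros [? ? ? ?] end end;
  rewrite ?/quat_dot ?/quat_trace ?/quat_norm;
  (try congr Quat) => /=; field.

(** If [s] is the denominator of [r], then [s ^ k] divides the numerator of [C] for every [k], which
    forces [s = 1]. This is how norms of elements of an order are shown to be integers. *)
Lemma rat_int_of_powers (C r : rat) :
  C != 0 -> (forall k, C * r ^+ k \is a Num.int) -> r \is a Num.int.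
Proof.
move=> C0 Cr; rewrite Qint_def; set s := `|denq r|%N.
have s0 : (0 < s)%N by rewrite absz_gt0 denq_neq0.
have sC k : (s ^ k %| `|numq C|)%N.
  have /intrP[m e] : (numq C)%:~R * r ^+ k \is a Num.int.
    by rewrite numqE mulrAC rpredM ?intr_int.
  have : (denq r ^+ k %| numq C * numq r ^+ k)%Z.
    apply/dvdzP; exists m; apply: (@intr_inj rat).
    rewrite !rmorphM !rmorphXn /= -e -mulrA -exprMn; congr (_ * _ ^+ k).
    by rewrite numqE.
  rewrite dvdzE abszM !abszX Gauss_dvdl //.
  by rewrite coprimeXl // coprimeXr // coprime_sym coprime_num_den.
have s1 : (s <= 1)%N.
  rewrite leqNgt; apply/negP => s1.
  have := dvdn_leq _ (sC `|numq C|%N); rewrite absz_gt0 numq_eq0 => /(_ C0).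
  by rewrite leqNgt ltn_expl.
have : s = 1%N by apply/eqP; rewrite eqn_leq s1.
by rewrite /s; case: (denq r) (denq_gt0 r) => // n _ /= ->.
Qed.

Lemma Gauss_int (p : nat) (r s : rat) : prime p ->
  r \is a Num.int -> s \is a Num.int -> r * s / p%:R \is a Num.int ->
  r / p%:R \is a Num.int \/ s / p%:R \is a Num.int.
Proof.
move=> pP /intrP[m ->] /intrP[n ->] /intrP[k e].
have p0 : (p%:R : rat) != 0 by rewrite pnatr_eq0 -lt0n prime_gt0.
have : (p %| m * n)%Z.
  apply/dvdzP; exists k; apply: (@intr_inj rat).
  by rewrite !rmorphM /= -e -pmulrn mulfVK.
rewrite dvdzE abszM Euclid_dvdM // => /orP[] h; [left|right];
  exact: (@Qint_dvdz _ p).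
Qed.

Lemma int_inverse_mod (p : nat) (r : rat) : prime p ->
  r \is a Num.int -> r / p%:R \isn't a Num.int ->
  exists2 s : rat, s \is a Num.int & (r * s - 1) / p%:R \is a Num.int.
Proof.
move=> pP /intrP[m ->] mp.
have p0 : (p%:R : rat) != 0 by rewrite pnatr_eq0 -lt0n prime_gt0.
have cop : coprimez m p.
  rewrite coprimezE coprime_sym prime_coprime //.
  by apply: contra mp => h; apply: (@Qint_dvdz _ p).
have [u [v e]] := Bezoutz m p.
exists u%:~R; first exact: intr_int.
suff -> : (m%:~R * u%:~R - 1) / p%:R = (- v)%:~R :> rat by exact: intr_int.
have : (u * m + v * p)%:~R = 1 :> rat by rewrite e (eqP cop).
rewrite rmorphD !rmorphM /= -pmulrn => e'.
by apply: (canLR (mulfK p0)); rewrite mulrNz; lra.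
Qed.

Section QuaternionIdentities.
Variables (K : comNzRingType) (a b : K).
Implicit Types x y z : quat a b.

Lemma quat_normM x y : quat_norm (x * y) = quat_norm x * quat_norm y.
Proof. quat_ring. Qed.
Lemma quat_normZ c x : quat_norm (c *: x) = c ^+ 2 * quat_norm x.
Proof. quat_ring. Qed.
Lemma quat_norm_scalar c : quat_norm (c%:A : quat a b) = c ^+ 2.
Proof. quat_ring. Qed.
Lemma quat_norm_conj x : quat_norm (quat_conj x) = quat_norm x.
Proof. quat_ring. Qed.
Lemma quat_normD x y : quat_norm (x + y) = quat_norm x + quat_dot x y + quat_norm y.
Proof. quat_ring. Qed.
Lemma quat_dotxx x : quat_dot x x = quat_norm x *+ 2.
Proof. quat_ring. Qed.
Lemma quat_dotC x y : quat_dot x y = quat_dot y x.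
Proof. quat_ring. Qed.
Lemma quat_dotDr x y z : quat_dot x (y + z) = quat_dot x y + quat_dot x z.
Proof. quat_ring. Qed.
Lemma quat_dotZr c x y : quat_dot x (c *: y) = c * quat_dot x y.
Proof. quat_ring. Qed.
Lemma quat_dotZ c x : quat_dot (c *: x) (c *: x) = c ^+ 2 * quat_dot x x.
Proof. quat_ring. Qed.
Lemma quat_dotE x y : quat_dot x y = quat_trace (x * quat_conj y).
Proof. quat_ring. Qed.
Lemma quat_traceMC x y : quat_trace (x * y) = quat_trace (y * x).
Proof. quat_ring. Qed.
Lemma quat_traceD x y : quat_trace (x + y) = quat_trace x + quat_trace y.
Proof. quat_ring. Qed.
Lemma quat_traceZ c x : quat_trace (c *: x) = c * quat_trace x.
Proof. quat_ring. Qed.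
Lemma quat_conjE x : quat_conj x = (quat_trace x)%:A - x.
Proof. quat_ring. Qed.
Lemma quat_norm_mulr x : quat_conj x * x = (quat_norm x)%:A.
Proof. quat_ring. Qed.
Lemma quat_sqr x : x * x = quat_trace x *: x - (quat_norm x)%:A.
Proof. quat_ring. Qed.

(* Modulo the trace ideal of [x], [x] semi-commutes with conjugation. *)
Lemma quat_mul_twist x y :
  x * y = quat_conj y * x + (quat_trace (x * y))%:A - quat_trace x *: quat_conj y.
Proof. quat_ring. Qed.
End QuaternionIdentities.

(** * Orders *)

Definition integral_quat {a b : rat} (x : quat a b) : Prop :=
  [/\ quat0 x \is a Num.int, quat1 x \is a Num.int,
      quat2 x \is a Num.int & quat3 x \is a Num.int].

Lemma integral_quatD (a b : rat) (x y : quat a b) :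
  integral_quat x -> integral_quat y -> integral_quat (x + y).
Proof. by move=> [????] [????]; split; apply: rpredD. Qed.

Lemma integral_quatZ (a b : rat) (c : rat) (x : quat a b) :
  c \is a Num.int -> integral_quat x -> integral_quat (c *: x).
Proof. by move=> ? [????]; split; apply: rpredM. Qed.

Lemma integral_quat_mulz (a b : rat) (x : quat a b) (m : int) :
  integral_quat x -> integral_quat (x *~ m).
Proof. by rewrite -scaler_int; apply/integral_quatZ/intr_int. Qed.

Lemma seq_quat_denominator (a b : rat) (s : seq (quat a b)) :
  exists2 c : nat, (0 < c)%N & forall x, x \in s -> integral_quat (c%:R *: x).
Proof.
elim: s => [|x s [c c0 IH]]; first by exists 1%N.
have [d d0 dP] : exists2 d : nat, (0 < d)%N & integral_quat (d%:R *: x).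
  have H (r : rat) (e : nat) : (`|denq r| %| e)%N -> e%:R * r \is a Num.int.
    move=> /dvdnP[k ->]; rewrite natrM -mulrA rpredM ?natr_int // mulrC.
    by rewrite natr_absz gtr0_norm ?denq_gt0 // -numqE intr_int.
  exists (`|denq (quat0 x)| * `|denq (quat1 x)| * `|denq (quat2 x)|
    * `|denq (quat3 x)|)%N; first by rewrite !muln_gt0 !absz_gt0 !denq_neq0.
  split; apply: H.
  + by rewrite -!mulnA dvdn_mulr.
  + by rewrite -!mulnA dvdn_mull // dvdn_mulr.
  + by rewrite -mulnA dvdn_mull // dvdn_mulr.
  + exact: dvdn_mull.
exists (c * d)%N; first by rewrite muln_gt0 c0.
move=> y; rewrite inE natrM => /predU1P[->|/IH ys].
  by rewrite -scalerA; apply: integral_quatZ dP; apply: natr_int.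
by rewrite mulrC -scalerA; apply: integral_quatZ ys; apply: natr_int.
Qed.

Section Order.
Variables (a b : rat) (O : set (quat a b)).
Hypothesis O_order : is_order O.
Implicit Types x y z : quat a b.

Lemma order_subring : subring_closed (mem O). Proof. by case: O_order. Qed.
Lemma order1 : O 1. Proof. by case: order_subring => /set_mem. Qed.
Lemma orderB x y : O x -> O y -> O (x - y).
Proof.
by case: order_subring => _ OB _ Ox Oy; apply/set_mem/OB; apply/mem_set.
Qed.
Lemma orderM x y : O x -> O y -> O (x * y).
Proof.
by case: order_subring => _ _ OM Ox Oy; apply/set_mem/OM; apply/mem_set.
Qed.
Lemma order0 : O 0. Proof. by rewrite -(subrr 1); apply/orderB; apply: order1. Qed.
Lemma orderN x : O x -> O (- x).
Proof. by rewrite -sub0r; apply/orderB/order0. Qed.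
Lemma orderD x y : O x -> O y -> O (x + y).
Proof. by move=> Ox /orderN; rewrite -{2}[y]opprK; apply: orderB. Qed.
Lemma orderZ (c : rat) x : c \is a Num.int -> O x -> O (c *: x).
Proof.
have On (n : nat) : O x -> O (n%:R *: x).
  by move=> Ox; elim: n => [|n IH]; rewrite ?scale0r -?natr1 ?scalerDl ?scale1r;
    [apply: order0 | apply: orderD].
move=> /intrP[[n ->|n ->]] Ox; first exact: On.
by rewrite NegzE mulrNz scaleNr; apply/orderN/On.
Qed.
Lemma order_scalar (c : rat) : c \is a Num.int -> O c%:A.
Proof. by move=> ci; apply/orderZ/order1. Qed.
Lemma order_nat (n : nat) : O n%:R.
Proof. by rewrite -scaler_nat; apply/order_scalar/natr_int. Qed.
Lemma orderX x n : O x -> O (x ^+ n).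
Proof.
move=> Ox; elim: n => [|n IH]; rewrite ?expr0 ?exprS; [exact: order1|].
exact: orderM.
Qed.

(** With [order_multiple], this places [O] between two multiples of the lattice of integral
    coordinates; the sandwich replaces the choice of a basis of [O]. *)
Lemma order_denominator :
  exists2 c : nat, (0 < c)%N & forall x, O x -> integral_quat (c%:R *: x).
Proof.
case: O_order => _ [n [s Os]] _.
have [c c0 cs] := seq_quat_denominator s; exists c => // x.
rewrite Os => -[f ->]; rewrite scaler_sumr.
apply: big_ind => [|y z|i _]; [by split | exact: integral_quatD |].
rewrite -scalerMzr; apply/integral_quat_mulz/cs.
by rewrite mem_nth // size_tuple.
Qed.

Lemma order_multiple :
  exists2 m : nat, (0 < m)%N & forall x, integral_quat x -> O (m%:R *: x).
Proof.
case: (O_order) => _ _ Om.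
have [k0 [p0 O0]] := Om 1.
have [k1 [p1 O1]] := Om (Quat 0 1 0 0).
have [k2 [p2 O2]] := Om (Quat 0 0 1 0).
have [k3 [p3 O3]] := Om (Quat 0 0 0 1).
exists (k0 * k1 * k2 * k3)%N; first by rewrite !muln_gt0 p0 p1 p2.
move=> x [i0 i1 i2 i3].
have -> : (k0 * k1 * k2 * k3)%N%:R *: x =
  ((k1 * k2 * k3)%N%:R * quat0 x) *: (1 *+ k0) +
  ((k0 * k2 * k3)%N%:R * quat1 x) *: (Quat 0 1 0 0 *+ k1) +
  ((k0 * k1 * k3)%N%:R * quat2 x) *: (Quat 0 0 1 0 *+ k2) +
  ((k0 * k1 * k2)%N%:R * quat3 x) *: (Quat 0 0 0 1 *+ k3).
  by rewrite -!scaler_nat !natrM; quat_ring.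
by do ![apply: orderD | apply: orderZ | apply: rpredM | apply: natr_int].
Qed.

Lemma order_norm_int x : O x -> quat_norm x \is a Num.int.
Proof.
move=> Ox; have [c c0 cP] := order_denominator.
(* [C] clears the denominators of the coordinates of every [x ^+ k], which stays in [O], and those
   of [a] and [b] in the norm form. *)
pose C : rat := c%:R ^+ 2 * (denq a)%:~R * (denq b)%:~R.
have C0 : C != 0.
  by rewrite !mulf_neq0 ?expf_neq0 ?intr_eq0 ?denq_neq0 ?pnatr_eq0 -?lt0n.
apply: (rat_int_of_powers C0) => k.
have -> : quat_norm x ^+ k = quat_norm (x ^+ k).
  elim: k => [|k IH]; last by rewrite !exprS IH quat_normM.
  by rewrite !expr0 -[in RHS](scale1r 1) quat_norm_scalar expr1n.
have [] := cP _ (orderX k Ox); case: (x ^+ k) => /= y0 y1 y2 y3 h0 h1 h2 h3.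
have -> : C * quat_norm (Quat y0 y1 y2 y3 : quat a b) =
   (denq a)%:~R * (denq b)%:~R * (c%:R * y0) ^+ 2
   - (a * (denq a)%:~R) * (denq b)%:~R * (c%:R * y1) ^+ 2
   - (b * (denq b)%:~R) * (denq a)%:~R * (c%:R * y2) ^+ 2
   + (a * (denq a)%:~R) * (b * (denq b)%:~R) * (c%:R * y3) ^+ 2.
  by rewrite /C; quat_ring.
rewrite -!numqE.
by do ![done | apply: rpredD | rewrite rpredN | apply: rpredM | apply: intr_int | apply: rpredX].
Qed.

Lemma order_trace_int x : O x -> quat_trace x \is a Num.int.
Proof.
move=> Ox; have -> : quat_trace x = quat_norm (x + 1) - quat_norm x - 1 by quat_ring.
by rewrite !rpredB ?order_norm_int //; apply: orderD order1.
Qed.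

Lemma order_conj x : O x -> O (quat_conj x).
Proof.
move=> Ox; rewrite quat_conjE; apply: orderB => //.
exact/order_scalar/order_trace_int.
Qed.

Lemma order_dot_int x y : O x -> O y -> quat_dot x y \is a Num.int.
Proof. by move=> Ox Oy; apply/order_trace_int/orderM/Oy/order_conj. Qed.
End Order.

(** The two hypotheses say exactly that [O + O c] is closed under products; generators [s] of [O]
    give generators [s] and [s c] of it, so it is an order. *)
Lemma maximal_order_adjoin (a b : rat) (O : set (quat a b)) (c : quat a b) :
  is_maximal_order O ->
  (forall u, O u -> exists v w, [/\ O v, O w & c * u = v + w * c]) ->
  (exists v w, [/\ O v, O w & c * c = v + w * c]) -> O c.
Proof.
move=> [O_order O_max] cO c2.
pose O' := [set x | exists v w, [/\ O v, O w & x = v + w * c]]%classic.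
have O'c : O' c by exists 0, 1; rewrite add0r mul1r; split=> //;
  [exact: order0 | exact: order1].
have OO' : (O `<=` O')%classic.
  by move=> x Ox; exists x, 0; rewrite mul0r addr0; split=> //; exact: order0.
rewrite -(O_max O') //; split.
- split; first by apply/mem_set; apply: OO'; apply: order1.
  + move=> x y /set_mem[v [w [Ov Ow ->]]] /set_mem[v' [w' [Ov' Ow' ->]]].
    apply/mem_set; exists (v - v'), (w - w'); split; try exact: orderB.
    by rewrite mulrBl opprD addrACA.
  + move=> x y /set_mem[v [w [Ov Ow ->]]] /set_mem[v' [w' [Ov' Ow' ->]]].
    have [s [t [Os Ot e1]]] := cO v' Ov'; have [s' [t' [Os' Ot' e2]]] := cO w' Ow'.
    have [p [q [Op Oq e3]]] := c2.
    apply/mem_set; exists (v * v' + w * s + w * t' * p), (v * w' + w * t + w * s' + w * t' * q).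
    split; do ?[apply: (orderD O_order) | apply: (orderM O_order)]; try done.
    rewrite mulrDl !mulrDr -(mulrA w c v') e1 -(mulrA w c) (mulrA c w') e2.
    rewrite (mulrDl s') -(mulrA t') e3 !mulrDr !mulrDl !mulrA.
    by rewrite [LHS](AC (2*(2*(1*2))) ((1*3*6)*(2*4*5*7))).
- case: (O_order) => _ [n [s Os]] _; exists (n + n)%N.
  exists (cat_tuple s (map_tuple ( *%R^~ c) s)).
  apply/seteqP; split=> x.
    move=> [v [w [+ + ->]]]; rewrite Os => -[f ->] [g ->].
    exists [ffun i => match split i with inl i => f i | inr i => g i end].
    rewrite big_split_ord /=; congr (_ + _).
      apply: eq_bigr => i _; rewrite ffunE nth_cat size_tuple ltn_ord.
      by case: splitP => [j /= /val_inj -> //|j /= e]; move: (ltn_ord i); rewrite e ltnNge leq_addr.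
    rewrite mulr_suml; apply: eq_bigr => i _.
    rewrite ffunE nth_cat size_tuple ltnNge leq_addr /= addKn.
    rewrite (nth_map 0) ?size_tuple // mulrzAl.
    case: splitP => [j /= e|j /= /addnI /val_inj -> //].
    by move: (ltn_ord j); rewrite -e ltnNge leq_addr.
  move=> [f ->]; rewrite big_split_ord /=.
  exists (\sum_(i < n) s`_i *~ f (lshift n i)), (\sum_(i < n) s`_i *~ f (rshift n i)).
  split.
  + by rewrite Os; exists [ffun i => f (lshift n i)]; apply: eq_bigr => i _; rewrite ffunE.
  + by rewrite Os; exists [ffun i => f (rshift n i)]; apply: eq_bigr => i _; rewrite ffunE.
  + congr (_ + _).
      by apply: eq_bigr => i _; rewrite nth_cat size_tuple ltn_ord.
    rewrite mulr_suml; apply: eq_bigr => i _.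
    rewrite nth_cat size_tuple ltnNge leq_addr /= addKn.
    by rewrite (nth_map 0) ?size_tuple // mulrzAl.
- by move=> x; case: (O_order) => _ _ /(_ x)[m [m0 Om]]; exists m; split=> //; apply: OO'.
Qed.

(** * The radical of the norm form modulo a prime *)

(** In the ramified case this is the two-sided ideal of [O] above [p]. Divisibility by [p] is
    expressed by integrality of rational quotients, and [p O] below by [O (p%:R^-1 *: x)]. *)
Definition norm_radical (a b : rat) (O : set (quat a b)) (p : nat) (x : quat a b) :=
  [/\ O x, quat_norm x / p%:R \is a Num.int &
      forall y, O y -> quat_trace (x * y) / p%:R \is a Num.int].

Section NormRadical.
Variables (a b : rat) (O : set (quat a b)) (p : nat).
Hypotheses (O_max : is_maximal_order O) (p_prime : prime p).
Implicit Types x y z u : quat a b.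

Let O_order : is_order O := proj1 O_max.
Local Notation pr := (p%:R : rat).
Let pr_neq0 : pr != 0. Proof. by rewrite pnatr_eq0 -lt0n prime_gt0. Qed.
Let pr_int : pr \is a Num.int. Proof. exact: natr_int. Qed.
Local Notation J := (norm_radical O p).
Local Notation divp x := (O (p%:R^-1 *: x)).

Lemma norm_radical_trace x : J x -> quat_trace x / p%:R \is a Num.int.
Proof. by case=> _ _ /(_ 1 (order1 O_order)); rewrite mulr1. Qed.

Lemma norm_radicalMr x u : J x -> O u -> J (x * u).
Proof.
move=> [Ox Nx tx] Ou; split; first exact: (orderM O_order).
  by rewrite quat_normM mulrAC rpredM // (order_norm_int O_order).
by move=> y Oy; rewrite -mulrA; apply/tx/(orderM O_order).
Qed.

Lemma norm_radicalMl x u : J x -> O u -> J (u * x).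
Proof.
move=> [Ox Nx tx] Ou; split; first exact: (orderM O_order).
  by rewrite quat_normM -mulrA rpredM // (order_norm_int O_order).
by move=> y Oy; rewrite -mulrA quat_traceMC -mulrA; apply/tx/(orderM O_order).
Qed.

Lemma norm_radical_conj x : J x -> J (quat_conj x).
Proof.
move=> [Ox Nx tx]; split; first exact: (order_conj O_order).
  by rewrite quat_norm_conj.
move=> y Oy; rewrite -/(quat_dot x y) quat_dotE.
exact/tx/(order_conj O_order).
Qed.

Lemma norm_radicalD x y : J x -> J y -> J (x + y).
Proof.
move=> [Ox Nx tx] [Oy Ny ty]; split; first exact: (orderD O_order).
  rewrite quat_normD 2!mulrDl !rpredD // quat_dotE.
  exact/tx/(order_conj O_order).
by move=> z Oz; rewrite [in X in quat_trace X]mulrDl quat_traceD mulrDl rpredD ?tx ?ty.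
Qed.

Lemma norm_radical_pO x : divp x -> J x.
Proof.
move=> Ox; have ex : x = pr *: (pr^-1 *: x) by rewrite scalerA divff ?scale1r.
split.
- by rewrite ex; apply: (orderZ O_order).
- rewrite ex quat_normZ expr2 mulrAC mulfK // rpredM //.
  exact: (order_norm_int O_order).
- move=> y Oy; rewrite ex -scalerAl quat_traceZ mulrAC mulfV // mul1r.
  exact/(order_trace_int O_order)/(orderM O_order).
Qed.

Lemma norm_radicalN x : J x -> J (- x).
Proof.
move=> Jx; rewrite -mulN1r; apply: norm_radicalMl => //.
exact/(orderN O_order)/(order1 O_order).
Qed.

Lemma norm_radicalB x y : J x -> J y -> J (x - y).
Proof. by move=> Jx /norm_radicalN; apply: norm_radicalD. Qed.

(* By maximality: otherwise [O + O (x / p)] would be a larger order. *)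
Lemma norm_radical_primitive x :
  J x -> quat_norm x / p%:R ^+ 2 \is a Num.int -> divp x.
Proof.
move=> Jx Nx; have tx := norm_radical_trace Jx.
have [Ox _ tJ] := Jx.
(* [quat_mul_twist] moves [u] across [x / p], with an error in [O] because the traces of [x] are
   divisible by [p]; the square is handled by [x ^ 2 = tr x * x - N x], where [p ^ 2] divides
   [N x]. *)
apply: maximal_order_adjoin => // [u Ou|].
  have Ocu : O (quat_conj u) by apply: (order_conj O_order).
  exists ((quat_trace (x * u) / pr)%:A - (quat_trace x / pr) *: quat_conj u).
  exists (quat_conj u); split=> //.
    by apply: (orderB O_order); [apply: (order_scalar O_order); apply: tJ |
      apply: (orderZ O_order)].
  by rewrite -scalerAl [in LHS]quat_mul_twist; quat_field.
exists (- (quat_norm x / pr ^+ 2)%:A), (quat_trace x / pr)%:A; split.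
- by apply: (orderN O_order); apply: (order_scalar O_order).
- exact: (order_scalar O_order).
- by quat_field.
Qed.

(** Each factor contributes one [p] to the norm, so [norm_radical_primitive] applies to the
    product. *)
Lemma norm_radicalM x y : J x -> J y -> divp (x * y).
Proof.
move=> Jx Jy; apply: norm_radical_primitive.
  by apply: norm_radicalMr => //; case: Jy.
case: Jx Jy => _ Nx _ [_ Ny _].
by rewrite quat_normM expr2 invfM mulrACA rpredM.
Qed.

Lemma divp_scale (r : rat) x : r \is a Num.int -> O x -> divp (r *: x) ->
  r / p%:R \is a Num.int \/ divp x.
Proof.
move=> ri Ox Orx; have [|rp] := boolP (r / p%:R \is a Num.int); first by left.
right; have [s si rs] := int_inverse_mod p_prime ri rp.
have -> : p%:R^-1 *: x = s *: (p%:R^-1 *: (r *: x)) - ((r * s - 1) / p%:R) *: x.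
  by rewrite !scalerA -scalerBl; congr (_ *: _); field.
by apply: (orderB O_order); apply: (orderZ O_order).
Qed.

Section Nontrivial.
Variable x0 : quat a b.
Hypotheses (Jx0 : J x0) (x0_prim : ~ divp x0).

(** The vector [x0] serves as a test: [z * x0] stays in the ideal [J], and its norm acquires a
    second factor [p]. *)
Lemma norm_radical_annihil z : O z -> quat_norm z / p%:R \is a Num.int ->
  divp (z * x0).
Proof.
move=> Oz Nz; apply: norm_radical_primitive; first exact: norm_radicalMl.
case: Jx0 => _ Nx _.
by rewrite quat_normM expr2 invfM mulrACA rpredM.
Qed.

(* [z] and its conjugate kill [x0] modulo [p], hence so does the trace of [z]. *)
Lemma trace_of_norm z : O z -> quat_norm z / p%:R \is a Num.int ->
  quat_trace z / p%:R \is a Num.int.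
Proof.
move=> Oz Nz; have Ocz := order_conj O_order Oz.
have h1 := norm_radical_annihil Oz Nz.
have h2 : divp (quat_conj z * x0).
  by apply: norm_radical_annihil; rewrite ?quat_norm_conj.
case: (@divp_scale (quat_trace z) x0) => //.
- exact: (order_trace_int O_order).
- by case: Jx0.
- rewrite -[quat_trace z *: x0]mulr_algl -quat_traceE mulrDl scalerDr.
  exact: (orderD O_order).
Qed.

(** The norm of [z * y] is again divisible by [p], so [trace_of_norm] bounds its trace. *)
Lemma norm_radicalP z : O z -> quat_norm z / p%:R \is a Num.int -> J z.
Proof.
move=> Oz Nz; split=> // y Oy; apply: trace_of_norm; first exact: (orderM O_order).
by rewrite quat_normM mulrAC rpredM // (order_norm_int O_order).
Qed.

Lemma norm_divp2 z : O z -> quat_norm z / p%:R ^+ 2 \is a Num.int -> divp z.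
Proof.
move=> Oz Nz; apply: norm_radical_primitive => //; apply: norm_radicalP => //.
have -> : quat_norm z / p%:R = p%:R * (quat_norm z / p%:R ^+ 2).
  by field.
by rewrite rpredM ?natr_int.
Qed.

(** A quantitative form of anisotropy: a norm highly divisible by [p] comes from a vector highly
    divisible by [p]. It is what excludes zeros over [Q_p]. *)
Lemma norm_divpX j z : O z -> quat_norm z / p%:R ^+ (2 * j) \is a Num.int ->
  O (p%:R^-1 ^+ j *: z).
Proof.
elim: j z => [|j IH] z Oz; first by rewrite expr0 scale1r.
rewrite mulnS exprD invfM mulrA => Nz.
rewrite exprSr -scalerA; apply: IH; last first.
  by rewrite quat_normZ exprVn [_^-1 * _]mulrC.
apply: norm_divp2 => //.
have -> : quat_norm z / p%:R ^+ 2 =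
  p%:R ^+ (2 * j) * (quat_norm z / p%:R ^+ 2 / p%:R ^+ (2 * j)).
  by rewrite [RHS]mulrC mulfVK // expf_neq0.
by rewrite rpredM // rpredX.
Qed.

(** If [u * x0] lies in [p O], multiplying by the conjugate of [u] puts [N u * x0] there; as [x0] is
    not in [p O], [p] divides [N u]. *)
Lemma norm_radical_mul_gen u : O u -> (divp (u * x0) <-> J u).
Proof.
move=> Ou; split=> [Oux|Ju]; last exact: norm_radicalM.
have Ocu := order_conj O_order Ou.
apply: norm_radicalP => //.
case: (@divp_scale (quat_norm u) x0) => //.
- exact: (order_norm_int O_order).
- by case: Jx0.
- rewrite -[quat_norm u *: x0]mulr_algl -quat_norm_mulr -mulrA scalerAr.
  exact: (orderM O_order).
Qed.

(** [N x0 / p] is prime to [p], say with inverse [s]. Then [s * (y * conj x0 / p)] times [x0] is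
    [s * (N x0 / p) * y], which is [y] modulo [p]; [norm_radicalM] puts [y * conj x0 / p] in [O]. *)
Lemma norm_radical_gen y : J y -> exists2 u, O u & divp (y - u * x0).
Proof.
move=> Jy; have [Ox0 Nx0 _] := Jx0; have [Oy _ _] := Jy.
have k_p : quat_norm x0 / p%:R / p%:R \isn't a Num.int.
  apply/negP => h; apply: x0_prim; apply: norm_divp2 => //.
  by rewrite expr2 invfM mulrA.
have [s si ks] := int_inverse_mod p_prime Nx0 k_p.
have Ow : divp (y * quat_conj x0).
  by apply: norm_radicalM => //; apply: norm_radical_conj.
exists (s *: (p%:R^-1 *: (y * quat_conj x0))); first exact: (orderZ O_order).
rewrite -!scalerAl -mulrA quat_norm_mulr -scalerAr mulr1 !scalerA.
rewrite -[X in X - _]scale1r -scalerBl scalerA.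
have -> : p%:R^-1 * (1 - s * p%:R^-1 * quat_norm x0) =
  - ((quat_norm x0 / p%:R * s - 1) / p%:R) by field.
by apply: (orderZ O_order); rewrite ?rpredN.
Qed.
End Nontrivial.
End NormRadical.

(** * Indices of subgroups *)

Section Index.
Variable V : zmodType.
Implicit Types (G H K : set V) (x y z : V).

Lemma zmod_closed_sub H x y : zmod_closed (mem H) -> H x -> H y -> H (x - y).
Proof. by case=> _ HB Hx Hy; apply/set_mem/HB; apply/mem_set. Qed.

Lemma zmod_closed_zero H : zmod_closed (mem H) -> H 0.
Proof. by case=> /set_mem. Qed.

Lemma zmod_closed_opp H x : zmod_closed (mem H) -> H x -> H (- x).
Proof.
move=> cH Hx; rewrite -sub0r; apply: zmod_closed_sub => //.
exact: zmod_closed_zero.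
Qed.

Lemma zmod_closed_add H x y : zmod_closed (mem H) -> H x -> H y -> H (x + y).
Proof.
move=> cH Hx Hy; rewrite -[y]opprK; apply: zmod_closed_sub => //.
exact: zmod_closed_opp.
Qed.

Lemma zmod_closedI H :
  H 0 -> (forall x y, H x -> H y -> H (x - y)) -> zmod_closed (mem H).
Proof.
move=> H0 HB; split; first exact/mem_set.
by move=> x y /set_mem Hx /set_mem Hy; apply/mem_set/HB.
Qed.

(** Representatives indexed by a finite type turn index computations into counting; no quotient
    group is formed. *)
Definition transversal_of G H (T : finType) (r : T -> V) :=
  [/\ forall t, G (r t), forall t s, H (r t - r s) -> t = s &
      forall x, G x -> exists t, H (x - r t)].

Definition has_index G H n :=
  exists (T : finType) (r : T -> V), transversal_of G H r /\ #|T| = n.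

(** Two representatives cannot share the same [g t]. Besides uniqueness of the index, this serves to
    find elements of [G] outside a family of fewer than [n] cosets. *)
Lemma has_index_cover_le G H n (T : finType) (g : T -> V) :
  zmod_closed (mem H) -> has_index G H n ->
  (forall x, G x -> exists t, H (x - g t)) -> (n <= #|T|)%N.
Proof.
move=> cH [S [r [[Gr r_inj _] <-]]] g_cover.
have [f fP] := choice (fun s => g_cover _ (Gr s)).
apply: (leq_card f) => s s' e; apply: r_inj.
have -> : r s - r s' = (r s - g (f s)) - (r s' - g (f s')).
  by rewrite e opprB addrA subrK.
exact: zmod_closed_sub.
Qed.

Lemma has_index_unique G H m n : zmod_closed (mem H) ->
  has_index G H m -> has_index G H n -> m = n.
Proof.
move=> cH Im In; apply/eqP; rewrite eqn_leq.
have [[T [r [[_ _ rP] eT]]] [S [s [[_ _ sP] eS]]]] := (Im, In).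
by rewrite -{1}eS -{2}eT (has_index_cover_le cH Im sP) (has_index_cover_le cH In rP).
Qed.

Lemma has_indexM G H K m n : zmod_closed (mem G) -> zmod_closed (mem H) ->
  (H `<=` G)%classic -> (K `<=` H)%classic ->
  has_index G H m -> has_index H K n -> has_index G K (m * n).
Proof.
move=> cG cH HG KH [T [r [[Gr r_inj rP] <-]]] [S [s [[Hs s_inj sP] <-]]].
exists (T * S)%type, (fun ts => r ts.1 + s ts.2); split; last exact: card_prod.
split=> [[t u]|[t u] [t' u']|x Gx] /=.
- by apply: zmod_closed_add => //; apply: HG.
- have e : r t + s u - (r t' + s u') = (r t - r t') + (s u - s u').
    by rewrite opprD addrACA.
  move=> Ke; have tt' : t = t'.
    apply: r_inj; have -> : r t - r t' = (r t + s u - (r t' + s u')) - (s u - s u').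
      by rewrite e addrK.
    by apply: zmod_closed_sub (KH _ Ke) _ => //; apply: zmod_closed_sub.
  by move: Ke; rewrite e tt' subrr add0r => /s_inj ->.
- have [t Ht] := rP x Gx; have [u Ku] := sP _ Ht.
  by exists (t, u) => /=; rewrite opprD addrA.
Qed.

(** The hypotheses say that [f] induces an isomorphism from [G / H] onto [G' / H']. *)
Lemma has_index_transfer G H G' H' (f : V -> V) n :
  {morph f : x y / x - y} ->
  (forall x, G x -> G' (f x)) -> (forall x y, G x -> G y -> G (x - y)) ->
  (forall x, G x -> H' (f x) <-> H x) ->
  (forall y, G' y -> exists2 x, G x & H' (y - f x)) ->
  zmod_closed (mem H') ->
  has_index G H n -> has_index G' H' n.
Proof.
move=> fB fG GB fH fS cH' [T [r [[Gr r_inj rP] <-]]].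
exists T, (f \o r); split=> //; split=> [t|t s|y G'y] /=.
- exact/fG.
- by rewrite -fB fH; [apply: r_inj | apply: GB].
- have [x Gx H'x] := fS y G'y; have [t Ht] := rP x Gx; exists t.
  have -> : y - f (r t) = (y - f x) + (f (x - r t)) by rewrite fB addrA subrK.
  by apply: zmod_closed_add => //; apply/fH => //; apply: GB.
Qed.

Lemma has_index_sup G H K n : zmod_closed (mem H) -> (K `<=` H)%classic ->
  has_index G K n -> exists m, has_index G H m.
Proof.
move=> cH KH [T [r [[Gr r_inj rP] _]]].
pose e t s := `[< H (r t - r s) >].
(* [c] selects one index in each class modulo [H]; its fixed points index the new transversal. *)
pose c t := odflt t [pick s | e t s].
have cP t : H (r t - r (c t)).
  rewrite /c; case: pickP => [s /asboolP //|/(_ t)] /=.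
  by rewrite /e subrr => /asboolP[]; apply: zmod_closed_zero.
have cE t s : H (r t - r s) -> c t = c s.
  move=> Hts; rewrite /c.
  have -> : [pick u | e t u] = [pick u | e s u].
    apply: eq_pick => u; apply/asboolP/asboolP => h.
      by rewrite -(subrKA (r t)); apply: zmod_closed_add => //; rewrite -opprB; apply: zmod_closed_opp.
    by rewrite -(subrKA (r s)); apply: zmod_closed_add.
  case: pickP => // /(_ s); rewrite /e subrr => /asboolP[].
  exact: zmod_closed_zero.
pose S := {t : T | c t == t}.
exists #|{: S}|, S, (r \o val); split=> //; split=> [t|t s Hts|x Gx] /=.
- exact: Gr.
- apply: val_inj; have [/eqP <- /eqP <-] := (valP t, valP s).
  exact: cE.
- have [t Kt] := rP x Gx.
  have cct : c (c t) == c t by apply/eqP/esym/cE.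
  exists (exist _ (c t) cct) => /=.
  by rewrite -(subrKA (r t)); apply: zmod_closed_add; rewrite // ?opprB //; apply: KH.
Qed.

Lemma has_index_sub G H K n : (H `<=` G)%classic -> (K `<=` H)%classic ->
  zmod_closed (mem K) ->
  has_index G K n -> exists m, has_index H K m.
Proof.
move=> HG KH cK [T [r [[Gr r_inj rP] _]]].
pose S := {t : T | `[< exists2 h, H h & K (h - r t) >]}.
have sP (s : S) : exists2 h, H h & K (h - r (val s)) by exact/asboolP/(valP s).
have [f fP] := choice (fun s => let: ex_intro2 h Hh Kh := sP s in
  ex_intro (fun h => H h /\ K (h - r (val s))) h (conj Hh Kh)).
exists #|{: S}|, S, f; split=> //; split=> [s|s s' Kss|x Hx].
- by case: (fP s).
- apply/val_inj/r_inj; have [_ k1] := fP s; have [_ k2] := fP s'.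
  have -> : r (val s) - r (val s') = (f s - f s') - (f s - r (val s)) + (f s' - r (val s')).
    by rewrite opprB [f s - f s' + _]addrC !addrA !subrK.
  by apply: zmod_closed_add => //; apply: zmod_closed_sub.
- have [t Kt] := rP x (HG _ Hx).
  have st : `[< exists2 h, H h & K (h - r t) >] by apply/asboolP; exists x.
  exists (exist _ t st); have [_ k] := fP (exist _ t st).
  have -> : x - f (exist _ t st) = (x - r t) - (f (exist _ t st) - r t).
    by rewrite opprB addrA subrK.
  exact: zmod_closed_sub.
Qed.

End Index.

Lemma coset_eqP (V : zmodType) (I : set V) (x x' : V) : zmod_closed (mem I) ->
  [set x + y | y in I] = [set x' + y | y in I] <-> I (x - x').
Proof.
move=> cI; split=> [e|Ixx'].
  have : [set x' + y | y in I] x.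
    by rewrite -e; exists 0; rewrite ?addr0 //; apply: zmod_closed_zero.
  by move=> [y Iy <-]; rewrite addrC addKr.
apply/seteqP; split=> z [y Iy <-].
  exists (x - x' + y); last by rewrite addrA [x' + _]addrC subrK.
  exact: zmod_closed_add.
exists (y - (x - x')); last by rewrite opprB addrCA [x + _]addrC subrK addrC.
exact: zmod_closed_sub.
Qed.

Lemma has_index_card (a b : rat) (O I : set (quat a b)) (n : nat) :
  zmod_closed (mem I) -> O 0 -> has_index O I n <-> cosets O I #= `I_n.
Proof.
move=> cI O0; split=> [[T [r [[Or r_inj rP] eT]]]|].
  have [t0 _] := rP 0 O0.
  apply/card_esym/card_set_bijP.
  exists (fun i => [set r (nth t0 (enum T) i) + y | y in I]); split.
  - by move=> i _; exists (r (nth t0 (enum T) i)).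
  - move=> i j /set_mem /= lei /set_mem /= lej /(coset_eqP _ _ cI) /r_inj /eqP.
    by rewrite nth_uniq ?enum_uniq -?cardE ?eT // => /eqP.
  - move=> C [x Ox <-]; have [t It] := rP x Ox.
    exists (index t (enum T)); first by rewrite /= -eT cardE index_mem mem_enum.
    by rewrite nth_index ?mem_enum //; apply/esym/coset_eqP.
move=> /card_esym/card_set_bijP[f [f_fun f_inj f_surj]].
have fP (i : 'I_n) : exists x, O x /\ [set x + y | y in I] = f i.
  by have [x Ox fx] := f_fun _ (ltn_ord i); exists x.
have [r rP] := choice fP.
exists 'I_n, r; split; last exact: card_ord.
split=> [i|i j|x Ox].
- by case: (rP i).
- move=> /(coset_eqP _ _ cI); case: (rP i) => _ ->; case: (rP j) => _ -> e.
  by apply/val_inj/f_inj => //; apply/mem_set; apply: ltn_ord.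
- have [i lti fi] := f_surj [set x + y | y in I] (ex_intro2 _ _ x Ox erefl).
  exists (Ordinal lti); apply/(coset_eqP _ _ cI).
  by case: (rP (Ordinal lti)) => _ ->.
Qed.

Lemma divn_int_witness (N : nat) (r : rat) : (0 < N)%N -> r \is a Num.int ->
  exists i : 'I_N, (N%:R^-1 * (r - (val i)%:R)) \is a Num.int.
Proof.
move=> N0 /intrP[m ->].
have lt : (`|(m %% N)%Z| < N)%N.
  by rewrite -ltz_nat gez0_abs ?modz_ge0 ?ltz_pmod // -lt0n.
exists (Ordinal lt) => /=.
have -> : (`|(m %% N)%Z|%:R : rat) = (m %% N)%Z%:~R.
  by rewrite -[in RHS](@gez0_abs (m %% N)%Z) ?modz_ge0 // -lt0n.
rewrite {1}(divz_eq m N) rmorphD rmorphM /= addrK mulrC mulfK ?intr_int //.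
by rewrite pnatr_eq0 -lt0n.
Qed.

Lemma eq_ord_mod (N : nat) (i j : 'I_N) :
  (N%:R^-1 * ((val i)%:R - (val j)%:R) : rat) \is a Num.int -> i = j.
Proof.
have N0 : (0 < N)%N := leq_ltn_trans (leq0n _) (ltn_ord i).
move=> h; apply: val_inj => /=; apply/eqP.
have Nr : 0 < N%:R :> rat by rewrite ltr0n.
have : N%:R^-1 * ((val i)%:R - (val j)%:R) == 0 :> rat.
  apply: contraTT (ltn_ord i) => ne0; rewrite -leqNgt.
  have := norm_intr_ge1 h ne0.
  rewrite normrM normfV normr_nat mulrC ler_pdivlMr // mul1r => le.
  case: (leqP j i) => ji.
    move: le; rewrite ger0_norm ?subr_ge0 ?ler_nat // => le.
    by rewrite -(ler_nat rat); apply: le_trans le _; rewrite gerDl oppr_le0.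
  move: le; rewrite distrC ger0_norm ?subr_ge0 ?ler_nat ?(ltnW ji) // => le.
  have := ltn_ord j; rewrite ltnNge -(ler_nat rat) => /negP[].
  by apply: le_trans le _; rewrite gerDl oppr_le0.
by rewrite mulf_eq0 invr_eq0 pnatr_eq0 eqn0Ngt N0 subr_eq0 eqr_nat.
Qed.

(** * The index of [p O] in an order *)

Section PrimeIndex.
Variables (a b : rat).
Local Notation Lambda := (@integral_quat a b).

Lemma zmod_closed_integral (c : rat) :
  zmod_closed (mem [set x | Lambda (c *: x)]).
Proof.
apply: zmod_closedI => [|x y] /=; rewrite ?scaler0 ?scalerBr; first by split.
by move=> [? ? ? ?] [? ? ? ?]; split; apply: rpredB.
Qed.

Lemma has_index_integral (N : nat) : (0 < N)%N ->
  has_index Lambda [set x | Lambda (N%:R^-1 *: x)] (N ^ 4).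
Proof.
move=> N0; exists ('I_N * 'I_N * 'I_N * 'I_N)%type.
exists (fun t => Quat (val t.1.1.1)%:R (val t.1.1.2)%:R (val t.1.2)%:R (val t.2)%:R).
split; last by rewrite !card_prod card_ord !expnS expn0 muln1 !mulnA.
split=> [t|[[[i j] k] l] [[[i' j'] k'] l'] [/= h0 h1 h2 h3]|x [x0 x1 x2 x3]].
- by split; apply: natr_int.
- by rewrite (eq_ord_mod h0) (eq_ord_mod h1) (eq_ord_mod h2) (eq_ord_mod h3).
- have [i ii] := divn_int_witness N0 x0; have [j jj] := divn_int_witness N0 x1.
  have [k kk] := divn_int_witness N0 x2; have [l ll] := divn_int_witness N0 x3.
  by exists (i, j, k, l); case: x x0 x1 x2 x3 ii jj kk ll => ????.
Qed.

Lemma zmod_closed_order_scale (O : set (quat a b)) (c : rat) : is_order O ->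
  zmod_closed (mem [set x | O (c *: x)]).
Proof.
move=> ordO; apply: zmod_closedI => [|x y] /=; rewrite ?scaler0 ?scalerBr.
  exact: (order0 ordO).
exact: (orderB ordO).
Qed.

Lemma has_index_scale (G H : set (quat a b)) (c : rat) (n : nat) : c != 0 ->
  zmod_closed (mem G) ->
  zmod_closed (mem [set x | H (c *: x)]) ->
  has_index G H n -> has_index [set x | G (c *: x)] [set x | H (c *: x)] n.
Proof.
move=> c0 cG cH; apply: (@has_index_transfer _ G H _ _ ( *:%R c^-1)) => //=.
- by move=> x y; rewrite scalerBr.
- by move=> x Gx; rewrite scalerA divff // scale1r.
- by move=> x y; apply: zmod_closed_sub.
- by move=> x Gx; rewrite scalerA divff // scale1r.
- move=> y Gy; exists (c *: y) => //.
  rewrite scalerA mulVf // scale1r subrr.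
  exact: (zmod_closed_zero cH).
Qed.

(** The index is compared with that of the coordinate lattice [Lambda]. With [O1 = c O] and
    [O2 = c p O], the index of [O2] in [Lambda] is computed through [O1] and through [p Lambda]. As
    [O2] has the same index in [p Lambda] as [O1] in [Lambda], cancelling it gives [p ^ 4] for [O2]
    in [O1]. *)
Lemma has_index_order_scale (O : set (quat a b)) (p : nat) : is_order O ->
  (0 < p)%N -> has_index O [set x | O (p%:R^-1 *: x)] (p ^ 4).
Proof.
move=> ordO p0; have [c c0 cP] := order_denominator ordO.
have [m m0 mP] := order_multiple ordO.
have cr : (c%:R : rat) != 0 by rewrite pnatr_eq0 -lt0n.
have mr : (m%:R : rat) != 0 by rewrite pnatr_eq0 -lt0n.
have pr : (p%:R : rat) != 0 by rewrite pnatr_eq0 -lt0n.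
pose O1 := [set x | O (c%:R^-1 *: x)].
pose O2 := [set x | O ((c%:R^-1 * p%:R^-1) *: x)].
have cO1 : zmod_closed (mem O1) by apply: zmod_closed_order_scale.
have cO2 : zmod_closed (mem O2) by apply: zmod_closed_order_scale.
have O1L : O1 `<=` Lambda.
  by move=> x /cP; rewrite scalerA divff // scale1r.
have O21 : O2 `<=` O1.
  move=> x O2x; rewrite /O1 /=.
  have -> : c%:R^-1 *: x = p%:R *: ((c%:R^-1 * p%:R^-1) *: x).
    by rewrite scalerA mulrCA divff // mulr1.
  by apply: (orderZ ordO) => //; apply: natr_int.
have LO1 : [set x | Lambda ((c * m)%N%:R^-1 *: x)] `<=` O1.
  move=> x /mP /=; rewrite scalerA natrM invfM mulrCA divff // mulr1.
  by [].
have LO2 : [set x | Lambda ((c * m * p)%N%:R^-1 *: x)] `<=` O2.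
  move=> x /mP /=; rewrite scalerA; congr (O (_ *: _)).
  by rewrite !natrM; field; rewrite cr mr pr.
have [k Ik] : exists k, has_index Lambda O1 k.
  apply: has_index_sup LO1 (has_index_integral _) => //.
  by rewrite muln_gt0 c0.
have cL : zmod_closed (mem (Lambda : set (quat a b))).
  rewrite (_ : (Lambda : set _) = [set x | Lambda (1 *: x)]).
    exact: zmod_closed_integral.
  by apply/seteqP; split=> x /=; rewrite scale1r.
have Ik' : has_index [set x | Lambda (p%:R^-1 *: x)] O2 k.
  have eO2 : O2 = [set x | O1 (p%:R^-1 *: x)].
    by apply/seteqP; split=> x; rewrite /O1 /O2 /= scalerA.
  rewrite eO2; apply: has_index_scale => //; first by rewrite invr_eq0.
  by rewrite -eO2.
have [l Il] : exists l, has_index O1 O2 l.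
  have [n In] : exists n, has_index Lambda O2 n.
    apply: has_index_sup LO2 (has_index_integral _) => //.
    by rewrite !muln_gt0 c0 m0.
  exact: has_index_sub O1L O21 cO2 In.
have Ikl : has_index Lambda O2 (k * l) by apply: has_indexM Ik Il.
have Ipk : has_index Lambda O2 (p ^ 4 * k).
  apply: has_indexM (has_index_integral p0) Ik' => //.
  + exact: zmod_closed_integral.
  + move=> x [i0 i1 i2 i3] /=.
    have -> : x = p%:R *: (p%:R^-1 *: x) by rewrite scalerA divff // scale1r.
    by apply: integral_quatZ; [apply: natr_int | split].
  + move=> x O2x; apply: O1L; rewrite /O1 /= scalerA; exact: O2x.
have k0 : (0 < k)%N.
  case: Ik => T [r [[_ _ rP] <-]]; have [t _] := rP 0 (zmod_closed_zero cL).
  by apply/card_gt0P; exists t.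
have -> : (p ^ 4 = l)%N.
  apply/eqP; rewrite -(eqn_pmul2l k0) mulnC; apply/eqP.
  exact: has_index_unique cO2 Ipk Ikl.
have := @has_index_scale O1 O2 c%:R l cr cO1.
rewrite (_ : [set x | O1 (c%:R *: x)] = O); last first.
  by apply/seteqP; split=> x; rewrite /O1 /= scalerA mulVf // scale1r.
rewrite (_ : [set x | O2 (c%:R *: x)] = [set x | O (p%:R^-1 *: x)]); last first.
  by apply/seteqP; split=> x; rewrite /O2 /= scalerA mulrAC mulVf // mul1r.
by apply => //; apply: zmod_closed_order_scale.
Qed.

End PrimeIndex.

(** * Structure at a prime *)

Lemma nat_div_int (m p : nat) : (0 < p)%N ->
  ((m%:R / p%:R : rat) \is a Num.int) = (p %| m)%N.
Proof.
move=> p0; apply/idP/idP => [/intrP[k e]|/dvdnP[k ->]]; last first.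
  by rewrite natrM mulfK ?natr_int // pnatr_eq0 -lt0n.
have pr : (p%:R : rat) != 0 by rewrite pnatr_eq0 -lt0n.
suff : (p%:Z %| m%:Z)%Z by rewrite dvdzE.
apply/dvdzP; exists k; apply: (@intr_inj rat).
by rewrite rmorphM /= -!pmulrn -e divfK.
Qed.

(** Squaring has fibres of at most two elements, so twice the number of squares is at least [p], and
    more since [p] is odd. Hence [A] and its affine image [B] of the same size meet. *)
Lemma sum_squares_pigeonhole (p : nat) (al be : 'F_p) :
  prime p -> odd p -> be != 0 ->
  exists r t : 'F_p, r ^+ 2 + al + be * t ^+ 2 = 0.
Proof.
move=> pP p_odd be0.
pose A := [set r ^+ 2 | r : 'F_p]%SET.
pose B := [set - al - be * s | s in A]%SET.
have cardB : #|B| = #|A|.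
  apply: card_imset => s s' /addrI /oppr_inj; exact: mulfI.
have pA : (p <= #|A| + #|A|)%N.
  rewrite addnn -muln2 -sum_nat_const -[p in (p <= _)%N](card_Fp pP) -sum1_card.
  rewrite (partition_big (fun r : 'F_p => r ^+ 2) (mem A)) /=; last first.
    by move=> r _; apply/imsetP; exists r.
  apply: leq_sum => s /imsetP[r0 _ ->].
  rewrite sum1_card; apply: leq_trans (_ : #|[set r0; - r0]%SET| <= 2)%N.
    by apply/subset_leq_card/fintype.subsetP => r; rewrite inE !inE /= -eqf_sqr.
  by rewrite cards2; case: (_ != _).
have [AB|] := boolP [disjoint A & B]; last first.
  rewrite -setI_eq0 => /set0Pn[_ /finset.setIP[/imsetP[r _ ->]]].
  case/imsetP=> _ /imsetP[t _ ->] e; exists r, t.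
  by rewrite e; ring.
have := max_card [in (A :|: B)%SET]; rewrite card_Fp // cardsU.
rewrite (disjoint_setI0 AB) cards0 subn0 cardB => le.
have /eqP e : (#|A| + #|A| == p)%N by rewrite eqn_leq le.
by have := congr1 odd e; rewrite addnn odd_double p_odd.
Qed.

Lemma intr_Fp_eq0 (p : nat) (m : int) : prime p ->
  ((m%:~R : 'F_p) == 0) = (p %| m)%Z.
Proof.
move=> pP; rewrite dvdzE /=.
case: m => n; last rewrite NegzE mulrNz oppr_eq0 abszN /=.
all: rewrite -pmulrn -(dvdn_pcharf (pchar_Fp pP)) //.
Qed.

Lemma sum_squares_mod (p : nat) (al be : rat) :
  prime p -> odd p -> al \is a Num.int -> be \is a Num.int ->
  be / p%:R \isn't a Num.int ->
  exists r t : rat, [/\ r \is a Num.int, t \is a Num.int &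
    (r ^+ 2 + al + be * t ^+ 2) / p%:R \is a Num.int].
Proof.
move=> pP p_odd /intrP[m ->] /intrP[n ->] np.
have n0 : (n%:~R : 'F_p) != 0.
  by rewrite intr_Fp_eq0 //; apply: contra np => /(@Qint_dvdz _ p).
have [r [t e]] := sum_squares_pigeonhole (m%:~R) pP p_odd n0.
exists (val r)%:R, (val t)%:R; split; try exact: natr_int.
have : ((val r)%:Z ^+ 2 + m + n * (val t)%:Z ^+ 2)%:~R == 0 :> 'F_p.
  rewrite !rmorphD !rmorphM /= -!pmulrn.
  by rewrite !natr_Zp -!expr2 e.
rewrite intr_Fp_eq0 // => /(@Qint_dvdz _ p).
by rewrite !rmorphD !rmorphM /= -!pmulrn.
Qed.

Lemma half_odd_add (r s : rat) : r \is a Num.int -> s \is a Num.int ->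
  r / 2%:R \isn't a Num.int -> s / 2%:R \isn't a Num.int ->
  (r + s) / 2%:R \is a Num.int.
Proof.
move=> /intrP[m ->] /intrP[n ->] m2 n2.
have m2' : ~~ (2 %| m)%Z by apply: contra m2 => /(@Qint_dvdz _ 2).
have n2' : ~~ (2 %| n)%Z by apply: contra n2 => /(@Qint_dvdz _ 2).
have : (2 %| m + n)%Z by lia.
by move=> /(@Qint_dvdz _ 2); rewrite rmorphD.
Qed.

Lemma half1_notint : (1 / 2%:R : rat) \isn't a Num.int.
Proof. by rewrite (nat_div_int 1). Qed.

Section PrimeOrder.
Variables (a b : rat) (O : set (quat a b)) (p : nat).
Hypotheses (O_max : is_maximal_order O) (p_prime : prime p).
Implicit Types x y z u : quat a b.

Let O_order : is_order O := proj1 O_max.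
Local Notation pr := (p%:R : rat).
Local Notation J := (norm_radical O p).
Local Notation divp x := (O (p%:R^-1 *: x)).

Let cpO : zmod_closed (mem [set x | divp x]).
Proof. exact: zmod_closed_order_scale. Qed.

Lemma zmod_closed_order : zmod_closed (mem O).
Proof. exact/GRing.subring_closedB/(order_subring O_order). Qed.

Lemma zmod_closed_norm_radical : zmod_closed (mem (J : set (quat a b))).
Proof.
apply: zmod_closedI => [|x y]; last exact: norm_radicalB.
by apply: norm_radical_pO => //; rewrite scaler0; apply: (order0 O_order).
Qed.

Let pO_J : [set x | divp x] `<=` J.
Proof. by move=> x; apply: norm_radical_pO. Qed.

Let J_O : (J : set (quat a b)) `<=` O.
Proof. by move=> x []. Qed.

Section Nontrivial.
Variable x0 : quat a b.
Hypotheses (Jx0 : J x0) (x0_prim : ~ divp x0).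

(* Right multiplication by [x0] identifies [O / J] with [J / p O]. *)
Lemma has_index_norm_radical : has_index O J (p ^ 2).
Proof.
have Ip := has_index_order_scale O_order (prime_gt0 p_prime).
have [n In] := has_index_sup zmod_closed_norm_radical pO_J Ip.
have In' : has_index J [set x | divp x] n.
  apply: (@has_index_transfer _ O J _ _ ( *%R^~ x0)) => // [x y|x Ox|x y|x Ox|y Jy].
  - by rewrite mulrBl.
  - exact: norm_radicalMl.
  - exact: (orderB O_order).
  - exact: (norm_radical_mul_gen O_max).
  - exact: (norm_radical_gen O_max).
have Inn := has_indexM zmod_closed_order zmod_closed_norm_radical J_O pO_J In In'.
have := has_index_unique cpO Ip Inn.
by rewrite (expnM p 2 2) -mulnn => /eqP; rewrite !mulnn eqn_exp2r // => /eqP ->.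
Qed.

(** Only [p = 2] can fail, as [tr 1 = 2]. If all traces were even, [N (x - 1)] would have the parity
    of [N x + 1], so the two cosets of 0 and 1 modulo [J] would cover [O], against the index 4. *)
Lemma exists_trace_unit :
  exists2 u, O u & quat_trace u / p%:R \isn't a Num.int.
Proof.
apply: contrapT => h.
have tr_p u : O u -> quat_trace u / p%:R \is a Num.int.
  by move=> Ou; apply: contrapT => /negP nu; apply: h; exists u.
have p2 : p = 2%N.
  have := tr_p 1 (order1 O_order).
  rewrite /quat_trace /= -[1 *+ 2]/(2%:R) nat_div_int ?prime_gt0 //.
  by rewrite dvdn_prime2 // => /eqP.
have : (p ^ 2 <= #|{: bool}|)%N.
  apply: (@has_index_cover_le _ O J _ _ (fun t : bool => if t then 1 else 0)).
  - exact: zmod_closed_norm_radical.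
  - exact: has_index_norm_radical.
  move=> x Ox; have Nx := order_norm_int O_order Ox.
  have [Nx2|Nx2] := boolP (quat_norm x / p%:R \is a Num.int).
    by exists false; rewrite subr0; apply: (norm_radicalP O_max p_prime Jx0).
  exists true; apply: (norm_radicalP O_max p_prime Jx0) => //.
    exact/(orderB O_order)/(order1 O_order).
  have -> : quat_norm (x - 1) = (quat_norm x + 1) - quat_trace x.
    by quat_ring.
  rewrite mulrBl rpredB ?tr_p //.
  move: Nx2; rewrite p2 => Nx2.
  by apply: half_odd_add half1_notint.
by rewrite p2 card_bool.
Qed.

(** The test element [conj z * u], with [tr u] prime to [p], gives that [p] divides [N z * tr u];
    the choice [u = 1] would fail at [p = 2]. *)
Lemma norm_radical_of_trace z : O z ->
  (forall y, O y -> quat_trace (z * y) / p%:R \is a Num.int) -> J z.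
Proof.
move=> Oz tz; have [u Ou tu] := exists_trace_unit.
apply: (norm_radicalP O_max p_prime Jx0) => //.
have Ozu : O (quat_conj z * u) by apply: (orderM O_order) => //; apply: (order_conj O_order).
have := tz _ Ozu; rewrite mulrA quat_normE mulr_algl quat_traceZ.
move=> /(Gauss_int p_prime (order_norm_int O_order Oz) (order_trace_int O_order Ou)).
by case=> //; rewrite (negPf tu).
Qed.

(** The same test element, now modulo [p ^ 2], shows that [p ^ 2] divides [N z]. *)
Lemma divp_of_trace2 z : O z ->
  (forall y, O y -> quat_trace (z * y) / p%:R ^+ 2 \is a Num.int) -> divp z.
Proof.
move=> Oz tz; have [u Ou tu] := exists_trace_unit.
have Jz : J z.
  apply: norm_radical_of_trace => // y Oy.
  have -> : quat_trace (z * y) / p%:R = p%:R * (quat_trace (z * y) / p%:R ^+ 2).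
    by field; rewrite pnatr_eq0 -lt0n prime_gt0.
  by rewrite rpredM ?natr_int ?tz.
apply: norm_radical_primitive => //.
have Ozu : O (quat_conj z * u) by apply: (orderM O_order) => //; apply: (order_conj O_order).
have := tz _ Ozu; rewrite mulrA quat_normE mulr_algl quat_traceZ.
rewrite expr2 invfM mulrA [_ * quat_trace u / _]mulrAC.
have [_ Nz _] := Jz.
move=> /(Gauss_int p_prime Nz (order_trace_int O_order Ou)).
by case; [rewrite mulrA | rewrite (negPf tu)].
Qed.
End Nontrivial.

Lemma not_divp1 : ~ divp 1.
Proof.
move=> /(order_norm_int O_order); rewrite quat_norm_scalar.
rewrite exprVn -natrX -[_^-1]mul1r (nat_div_int 1) ?expn_gt0 ?prime_gt0 //.
by rewrite dvdn1 -{2}(exp1n 2) eqn_exp2r // => /eqP p1; move: p_prime; rewrite p1.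
Qed.

Lemma divp_mulz (r : rat) x : O x -> r / p%:R \is a Num.int -> divp (r *: x).
Proof.
move=> Ox rp; rewrite scalerA mulrC; exact: (orderZ O_order).
Qed.

Lemma ord_of_int (r : rat) : r \is a Num.int -> exists i : 'I_p, (r - i%:R) / p%:R \is a Num.int.
Proof.
by move=> /(divn_int_witness (prime_gt0 p_prime))[i]; exists i; rewrite mulrC.
Qed.

(** The classes of [1], [x] and [y] are independent in [O / p O]: the [p] multiples of 1, then the
    [p ^ 2] combinations of 1 and [x], cannot cover [p ^ 4] cosets. *)
Lemma exists_independent : exists x y, [/\ O x, O y &
  forall r s t : rat, r \is a Num.int -> s \is a Num.int -> t \is a Num.int ->
    divp (r%:A + s *: x + t *: y) ->
    [/\ r / p%:R \is a Num.int, s / p%:R \is a Num.int & t / p%:R \is a Num.int]].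
Proof.
have Ip := has_index_order_scale O_order (prime_gt0 p_prime).
have O1 := order1 O_order.
have p1 := prime_gt1 p_prime.
have [x Ox xP] : exists2 x, O x & forall r : rat, r \is a Num.int -> ~ divp (x - r%:A).
  apply: contrapT => h.
  have : (p ^ 4 <= #|{: 'I_p}|)%N.
    apply: (has_index_cover_le (g := fun i : 'I_p => (i%:R)%:A) cpO Ip) => x Ox.
    apply: contrapT => h'; apply: h; exists x => // r ri dr; apply: h'.
    have [i ii] := ord_of_int ri; exists i => /=.
    have -> : x - (i%:R)%:A = (x - r%:A) + (r - i%:R)%:A.
      by rewrite scalerBl addrA subrK.
    by rewrite scalerDr; apply: (orderD O_order) => //; apply: divp_mulz.
  by rewrite card_ord -{2}(expn1 p) leq_exp2l.
have [y Oy yP] : exists2 y, O y & forall r s : rat, r \is a Num.int ->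
    s \is a Num.int -> ~ divp (y - (r%:A + s *: x)).
  apply: contrapT => h.
  have : (p ^ 4 <= #|{: 'I_p * 'I_p}|)%N.
    apply: (has_index_cover_le (g := fun i : 'I_p * 'I_p => (i.1%:R)%:A + i.2%:R *: x) cpO Ip) => y Oy.
    apply: contrapT => h'; apply: h; exists y => // r s ri si drs; apply: h'.
    have [i ii] := ord_of_int ri; have [j jj] := ord_of_int si; exists (i, j) => /=.
    have -> : y - ((i%:R)%:A + j%:R *: x) =
       (y - (r%:A + s *: x)) + ((r - i%:R)%:A + (s - j%:R) *: x).
      by rewrite !scalerBl; quat_ring.
    rewrite scalerDr; apply: (orderD O_order) => //.
    by rewrite scalerDr; apply: (orderD O_order); apply: divp_mulz.
  by rewrite card_prod card_ord mulnn leq_exp2l.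
exists x, y; split=> // r s t ri si ti drst.
have tp : t / p%:R \is a Num.int.
  apply: contrapT => /negP tp; have [t' t'i tt'] := int_inverse_mod p_prime ti tp.
  apply: (yP (- t' * r) (- t' * s)); rewrite ?rpredM ?rpredN //.
  have -> : y - ((- t' * r)%:A + (- t' * s) *: x) =
     t' *: (r%:A + s *: x + t *: y) - (t * t' - 1) *: y by quat_ring.
  rewrite scalerBr; apply: (orderB O_order); last exact: divp_mulz.
  by rewrite scalerA mulrC -scalerA; apply: (orderZ O_order).
have drs : divp (r%:A + s *: x).
  have -> : r%:A + s *: x = (r%:A + s *: x + t *: y) - t *: y by rewrite addrK.
  by rewrite scalerBr; apply: (orderB O_order) => //; apply: divp_mulz.
have sp : s / p%:R \is a Num.int.
  apply: contrapT => /negP sp; have [s' s'i ss'] := int_inverse_mod p_prime si sp.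
  apply: (xP (- s' * r)); rewrite ?rpredM ?rpredN //.
  have -> : x - (- s' * r)%:A = s' *: (r%:A + s *: x) - (s * s' - 1) *: x by quat_ring.
  rewrite scalerBr; apply: (orderB O_order); last exact: divp_mulz.
  by rewrite scalerA mulrC -scalerA; apply: (orderZ O_order).
split=> //.
have : divp (r%:A).
  have -> : r%:A = (r%:A + s *: x) - s *: x by rewrite addrK.
  by rewrite scalerBr; apply: (orderB O_order) => //; apply: divp_mulz.
by case/(divp_scale O_max p_prime ri O1) => // /not_divp1.
Qed.

(** A case of Chevalley's theorem: the norm form modulo [p], restricted to the span of [1], [x],
    [y], is a form in three variables. *)
Lemma exists_isotropic :
  exists z, [/\ O z, ~ divp z & quat_norm z / p%:R \is a Num.int].
Proof.
have [x [y [Ox Oy indep]]] := exists_independent.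
have O1 := order1 O_order.
have [i0 i1] := (int_num0 rat, int_num1 rat).
have one_p : (1 / p%:R : rat) \isn't a Num.int.
  by rewrite (nat_div_int 1) ?prime_gt0 // dvdn1 gtn_eqF ?prime_gt1.
have [p_odd|p_even] := boolP (odd p); last first.
  have p2 : p = 2%N by case: (even_prime p_prime) p_even => // ->.
  (* For [p = 2], an even trace makes [N z] or [N (z + 1)] even. One of [x], [y], [x + y] has even
     trace. *)
  have even_trace z : O z -> quat_trace z / p%:R \is a Num.int -> ~ divp z ->
      ~ divp (z + 1) -> exists z, [/\ O z, ~ divp z & quat_norm z / p%:R \is a Num.int].
    move=> Oz tz nz nz1; have [Nz|Nz] := boolP (quat_norm z / p%:R \is a Num.int).
      by exists z.
    exists (z + 1); split=> //; first exact: (orderD O_order).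
    have -> : quat_norm (z + 1) = (quat_norm z + 1) + quat_trace z by quat_ring.
    rewrite mulrDl rpredD //.
    move: Nz; rewrite p2 => Nz.
    by apply: half_odd_add half1_notint => //; apply: (order_norm_int O_order).
  have nx : ~ divp x.
    have := indep 0 1 0 i0 i1 i0; rewrite !scale0r add0r addr0 scale1r => h /h[].
    by rewrite (negPf one_p).
  have nx1 : ~ divp (x + 1).
    have := indep 1 1 0 i1 i1 i0; rewrite !scale0r addr0 !scale1r addrC => h /h[].
    by rewrite (negPf one_p).
  have ny : ~ divp y.
    have := indep 0 0 1 i0 i0 i1; rewrite !scale0r !add0r scale1r => h /h[].
    by rewrite (negPf one_p).
  have ny1 : ~ divp (y + 1).
    have := indep 1 0 1 i1 i0 i1; rewrite !scale0r addr0 !scale1r addrC => h /h[].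
    by rewrite (negPf one_p).
  have nxy : ~ divp (x + y).
    have := indep 0 1 1 i0 i1 i1; rewrite !scale0r add0r !scale1r => h /h[].
    by rewrite (negPf one_p).
  have nxy1 : ~ divp (x + y + 1).
    have := indep 1 1 1 i1 i1 i1; rewrite !scale1r -addrA addrC => h /h[].
    by rewrite (negPf one_p).
  have [tx|tx] := boolP (quat_trace x / p%:R \is a Num.int); first exact: (even_trace x).
  have [ty|ty] := boolP (quat_trace y / p%:R \is a Num.int); first exact: (even_trace y).
  apply: (even_trace (x + y)) => //; first exact: (orderD O_order).
  rewrite quat_traceD.
  move: tx ty; rewrite p2 => tx ty.
  by apply: half_odd_add tx ty; apply: (order_trace_int O_order).
have two_p : (2 / p%:R : rat) \isn't a Num.int.
  rewrite (nat_div_int 2) ?prime_gt0 // dvdn_prime2 //.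
  by apply: contraTneq p_odd => ->.
have i2 : (2 : rat) \is a Num.int by exact: (natr_int _ 2).
pose tx := quat_trace x; pose ty := quat_trace y.
have txi : tx \is a Num.int by exact: (order_trace_int O_order).
have tyi : ty \is a Num.int by exact: (order_trace_int O_order).
(* Gram-Schmidt without division: [u] is orthogonal to 1, and [v] below to 1 and [u], so the form
   becomes diagonal. The zero coefficient of [y] gives [u] the shape expected by [indep]. *)
pose u := (- tx)%:A + 2 *: x + 0 *: y.
have Ou : O u.
  by rewrite /u; do ![apply: (orderD O_order) | apply: (orderZ O_order)];
    rewrite ?rpredN.
have nu : ~ divp u by move/indep; rewrite rpredN (negPf two_p) => -[].
have [Nu|Nu] := boolP (quat_norm u / p%:R \is a Num.int); first by exists u.
have Nui := order_norm_int O_order Ou.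
pose y' := 2 *: y - ty%:A.
have Oy' : O y' by apply: (orderB O_order); apply: (orderZ O_order).
pose B := quat_dot y' u.
have Bi : B \is a Num.int by apply: (order_dot_int O_order).
pose n := quat_norm u.
pose v := (- (2 * n * ty) + B * tx)%:A + (- (2 * B)) *: x + (4 * n) *: y.
have vE : v = (2 * n) *: y' - B *: u.
  by rewrite /v /u /y'; quat_ring.
have v0 : quat_trace v = 0.
  by rewrite vE /y' /u /tx /ty; quat_ring.
have vu : quat_dot u v = 0.
  rewrite vE; have -> : quat_dot u ((2 * n) *: y' - B *: u) =
     2 * n * quat_dot y' u - B * (2 * quat_norm u).
    by quat_ring.
  by rewrite -/B -/n; ring.
have u0 : quat_trace u = 0 by rewrite /u /tx; quat_ring.
have coef : 4 * n / p%:R \isn't a Num.int.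
  apply/negP; have -> : 4 * n = 2 * (2 * n) by ring.
  move=> /(Gauss_int p_prime i2 (rpredM i2 Nui))[|]; first by rewrite (negPf two_p).
  by move=> /(Gauss_int p_prime i2 Nui)[|]; rewrite ?(negPf two_p) ?(negPf Nu).
have i4 : (4 : rat) \is a Num.int by exact: (natr_int _ 4).
have ci : - (2 * n * ty) + B * tx \is a Num.int.
  by rewrite rpredD ?rpredN ?rpredM.
have iB : - (2 * B) \is a Num.int by rewrite rpredN rpredM.
have i4n : 4 * n \is a Num.int by rewrite rpredM.
have Ov : O v.
  by do ![apply: (orderD O_order) | apply: (orderZ O_order)].
have nv : ~ divp v.
  by move=> /(indep _ _ _ ci iB i4n)[_ _]; rewrite (negPf coef).
have [Nv|Nv] := boolP (quat_norm v / p%:R \is a Num.int); first by exists v.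
have Nvi := order_norm_int O_order Ov.
have [r [t [ri ti rt]]] := sum_squares_mod p_prime p_odd Nui Nvi Nv.
exists (r%:A + u + t *: v); split.
- by do ![done | apply: (orderD O_order) | apply: (orderZ O_order)].
- have -> : r%:A + u + t *: v =
    (r - tx + t * (- (2 * n * ty) + B * tx))%:A + (2 - t * (2 * B)) *: x + (t * (4 * n)) *: y.
    by rewrite /u /v; quat_ring.
  move=> /(indep _ _ _ (rpredD (rpredB ri txi) (rpredM ti ci))
    (rpredB i2 (rpredM ti (rpredM i2 Bi))) (rpredM ti i4n))[_ h1].
  (* The coefficient of [y] forces [p] to divide [t]; that of [x], which is [2 - 2 t B], would then
     make [p] divide 2. *)
  move=> /(Gauss_int p_prime ti i4n)[tp|]; last by rewrite (negPf coef).
  move: two_p; apply/negP/negPn.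
  have -> : 2 / p%:R = (2 - t * (2 * B)) / p%:R + t / p%:R * (2 * B) by ring.
  by rewrite rpredD // rpredM // rpredM.
- have -> : quat_norm (r%:A + u + t *: v) = r ^+ 2 + quat_norm u + quat_norm v * t ^+ 2
      + r * quat_trace u + r * t * quat_trace v + t * quat_dot u v.
    by quat_ring.
  by rewrite u0 v0 vu !mulr0 !addr0.
Qed.

End PrimeOrder.

(** * p-adic lifting and ramification *)

Section RatrChar0.
Variable F : fieldType.
Hypothesis F_char0 : forall m : int, (m%:~R == 0 :> F) = (m == 0).

(** Any fraction representing [x] computes [ratr x] in characteristic 0, so that [ratr] is additive
    and multiplicative also in [padic], where no order is at hand. *)
Lemma ratr_eq_frac (x : rat) (n d : int) : d != 0 ->
  x * d%:~R = n%:~R -> (ratr x : F) * d%:~R = n%:~R.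
Proof.
move=> d0 e; have dx0 : (denq x)%:~R != 0 :> F by rewrite F_char0 denq_neq0.
have {}e : numq x * d = n * denq x.
  apply: (@intr_inj rat); rewrite !rmorphM /= -e numqE; ring.
rewrite /ratr mulrAC -rmorphM /= e rmorphM /= mulfK //.
Qed.

Lemma ratr_frac (x : rat) : (ratr x : F) * (denq x)%:~R = (numq x)%:~R.
Proof. by apply: ratr_eq_frac; rewrite ?denq_neq0 // numqE. Qed.

Lemma ratrD0 (x y : rat) : (ratr (x + y) : F) = ratr x + ratr y.
Proof.
have d0 : denq x * denq y != 0 by rewrite mulf_neq0 ?denq_neq0.
apply: (mulIf (_ : (denq x * denq y)%:~R != 0 :> F)); first by rewrite F_char0.
rewrite (@ratr_eq_frac _ (numq x * denq y + numq y * denq x)) //; last first.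
  by rewrite rmorphD !rmorphM /= !numqE; ring.
by rewrite rmorphD !rmorphM /= -!ratr_frac; ring.
Qed.

Lemma ratrM0 (x y : rat) : (ratr (x * y) : F) = ratr x * ratr y.
Proof.
have d0 : denq x * denq y != 0 by rewrite mulf_neq0 ?denq_neq0.
apply: (mulIf (_ : (denq x * denq y)%:~R != 0 :> F)); first by rewrite F_char0.
rewrite (@ratr_eq_frac _ (numq x * numq y)) //; last first.
  by rewrite !rmorphM /= !numqE; ring.
by rewrite !rmorphM /= -!ratr_frac; ring.
Qed.

Lemma ratrN0 (x : rat) : (ratr (- x) : F) = - ratr x.
Proof. by rewrite -mulN1r ratrM0 (ratr_int F (-1)) mulN1r. Qed.

Lemma quat_norm_incl (a b : rat) (x : quat a b) :
  quat_norm (quat_incl F x) = ratr (quat_norm x).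
Proof.
by case: x => *; rewrite /quat_norm /= !(ratrD0, ratrN0, ratrM0, expr2).
Qed.

Lemma quat_dot_incl (a b : rat) (x y : quat a b) :
  quat_dot (quat_incl F x) (quat_incl F y) = ratr (quat_dot x y).
Proof.
case: x => *; case: y => *; rewrite /quat_dot /quat_trace /=.
by rewrite !mulr2n !(ratrD0, ratrN0, ratrM0, expr2).
Qed.
End RatrChar0.

Lemma quat_unit (F : fieldType) (a b : F) (x : quat a b) : quat_norm x != 0 ->
  exists y, x * y = 1 /\ y * x = 1.
Proof.
move=> N0; exists ((quat_norm x)^-1 *: quat_conj x); split.
  by rewrite -scalerAr quat_normE scalerA mulVf // scale1r.
by rewrite -scalerAl quat_norm_mulr scalerA mulVf // scale1r.
Qed.

Lemma quat_norm_neq0 (F : fieldType) (a b : F) (x y : quat a b) :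
  x * y = 1 -> quat_norm x != 0.
Proof.
move=> xy; have := congr1 (fun z => quat_norm z) xy.
rewrite quat_normM => e; apply/eqP => N0; move: e; rewrite N0 mul0r.
by rewrite -[1 in RHS]scale1r quat_norm_scalar expr1n => /eqP; rewrite eq_sym oner_eq0.
Qed.

Lemma fraction_num_den (R : idomainType) (x : {fraction R}) :
  exists n d : R, d != 0 /\ x * tofrac d = tofrac n.
Proof.
elim/quotW: x => r; exists (\n_r)%R, (\d_r)%R; split; first exact: denom_ratioP.
unlock tofrac; rewrite -[LHS]pi_mul; apply/eqmodP.
by rewrite /= FracField.equivfE /FracField.mulf /= !numden_Ratio ?mulf_neq0 ?denom_ratioP ?oner_eq0 //; apply/eqP; ring.
Qed.

Section PadicResidues.
Variables (p : nat) (p_pr : prime p).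
Implicit Types (x y : padic_int p_pr) (c d : int) (n : nat).
Local Notation pn n := (Posz (p ^ n)).

Definition padic_cong n x c := (pn n %| x n - c)%Z.

Lemma padic_cong_res n x : padic_cong n x (x n).
Proof. by rewrite /padic_cong subrr dvdz0. Qed.

Lemma padic_congD n x y c d :
  padic_cong n x c -> padic_cong n y d -> padic_cong n (x + y) (c + d).
Proof.
rewrite /padic_cong -!eqz_mod_dvd => /eqP e1 /eqP e2; apply/eqP => /=.
by rewrite modz_mod -modzDm e1 e2 modzDm.
Qed.

Lemma padic_congM n x y c d :
  padic_cong n x c -> padic_cong n y d -> padic_cong n (x * y) (c * d).
Proof.
rewrite /padic_cong -!eqz_mod_dvd => /eqP e1 /eqP e2; apply/eqP => /=.
by rewrite modz_mod -modzMm e1 e2 modzMm.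
Qed.

Lemma padic_congN n x c : padic_cong n x c -> padic_cong n (- x) (- c).
Proof.
rewrite /padic_cong -!eqz_mod_dvd => /eqP e1; apply/eqP => /=.
by rewrite modz_mod -modzNm e1 modzNm.
Qed.

Lemma padic_cong_const n c : padic_cong n (padic_const p_pr c) c.
Proof. by rewrite /padic_cong -eqz_mod_dvd /= modz_mod. Qed.

Lemma padic_cong_int n c : padic_cong n c%:~R c.
Proof.
have nat_case (k : nat) : padic_cong n (k%:R : padic_int p_pr) k.
  elim: k => [|k IH]; first exact: padic_cong_const.
  rewrite -natr1 -addn1 PoszD; apply: padic_congD => //; exact: padic_cong_const.
case: c => k; first exact: nat_case.
by rewrite NegzE mulrNz; apply/padic_congN/nat_case.
Qed.

Lemma padic_cong0 n c : padic_cong n 0 c -> (pn n %| c)%Z.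
Proof. by rewrite /padic_cong /= mod0z sub0r rpredN. Qed.

Lemma padic_eq0P x : (forall n, padic_cong n x 0) -> x = 0.
Proof.
move=> h; apply: padic_intP => n /=; rewrite mod0z -[x n]padic_resK.
by apply/dvdz_mod0P; have := h n; rewrite /padic_cong subr0.
Qed.

Lemma padic_intr_eq0 c : (c%:~R == 0 :> padic_int p_pr) = (c == 0).
Proof.
apply/eqP/eqP => [e|->//]; have := padic_cong_int `|c|%N c.
rewrite e => /padic_cong0; rewrite dvdzE /= => /dvdn_leq h.
apply/eqP; rewrite -absz_eq0; apply: contraT; rewrite -lt0n => /h.
by rewrite leqNgt ltn_expl ?prime_gt1.
Qed.

Lemma padic_field_char0 c : (c%:~R == 0 :> padic p_pr) = (c == 0).
Proof.
have -> : (c%:~R : padic p_pr) = tofrac (c%:~R : padic_int p_pr) by rewrite rmorph_int.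
by rewrite tofrac_eq0 padic_intr_eq0.
Qed.

(* Newton iteration with a fixed approximate inverse [u] of the derivative. *)
Lemma padic_hensel (n t m : int) : (p %| m)%Z -> ~~ (p %| t)%Z ->
  exists k : padic_int p_pr,
    n%:~R * k ^+ 2 + t%:~R * k + m%:~R = 0 /\ padic_cong 1 k 0.
Proof.
move=> pm pt; pose P g : int := n * g ^+ 2 + t * g + m.
have cop : coprimez t p by rewrite coprimezE coprime_sym prime_coprime.
have [u [v uv]] := Bezoutz t p.
have {}uv : u * t = 1 - v * p by move: cop uv; rewrite /coprimez => /eqP ->; lia.
pose g := fix g (k : nat) : int := if k is k'.+1 then g k' - u * P (g k') else 0.
have gP k : (p %| g k)%Z /\ (pn k.+1 %| P (g k))%Z.
  elim: k => [|k [/dvdzP[h eh] /dvdzP[l el]]]; first by rewrite expn1 /P /= dvdz0 expr0n /= !mulr0 !add0r.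
  have pP : (p %| P (g k))%Z by apply/dvdzP; exists (l * pn k); rewrite el expnS PoszM; ring.
  have [l' el'] := dvdzP pP.
  have gS : g k.+1 = g k - u * P (g k) by [].
  split; first by rewrite gS el' eh; apply/dvdzP; exists (h - u * l'); ring.
  (* Exact Taylor expansion. The cofactor is divisible by [p], since [1 - u * t = v * p] and [p]
     divides both [g k] and [P (g k)]. *)
  have -> : P (g k.+1) = P (g k) * (1 - u * t - 2 * n * u * g k + u ^+ 2 * P (g k) * n).
    by rewrite gS /P; ring.
  rewrite {1}el uv el' eh (expnS _ k.+1) PoszM.
  by apply/dvdzP; exists (l * (v - 2 * n * u * h + u ^+ 2 * l' * n)); ring.
have g_coh k : (g k.+1 = g k %[mod pn k])%Z.
  apply/eqP; rewrite eqz_mod_dvd /= addrAC subrr add0r rpredN dvdz_mull //.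
  have [_] := gP k; apply: dvdz_trans; rewrite expnS PoszM; exact: dvdz_mull.
have kP j : padic_cong j (padic_mk p_pr g_coh) (g j).
  by rewrite /padic_cong -eqz_mod_dvd /= modz_mod.
exists (padic_mk p_pr g_coh); split.
  apply: padic_eq0P => j.
  have h : padic_cong j (n%:~R * padic_mk p_pr g_coh ^+ 2
      + t%:~R * padic_mk p_pr g_coh + m%:~R) (P (g j)).
    rewrite expr2 /P expr2; do !apply: padic_congD; do ?apply: padic_congM;
      (exact: kP || exact: padic_cong_int).
  have [_ pj] := gP j.
  have pj' : (pn j %| P (g j))%Z.
    by apply: dvdz_trans pj; rewrite expnS PoszM; exact: dvdz_mull.
  rewrite /padic_cong subr0 -[X in (_ %| X)%Z](subrK (P (g j))).
  by rewrite rpredD.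
have := kP 1%N; have [p1 _] := gP 1%N; rewrite /padic_cong expn1 => h.
rewrite subr0 -[X in (_ %| X)%Z](subrK (g 1%N)) rpredD //.
Qed.
End PadicResidues.

(** The loss [e] is the valuation of [C], and does not depend on [n] or [r]. *)
Lemma prime_power_absorb (p : nat) (C : int) : prime p -> C != 0 ->
  exists e, forall (n : nat) (r : int), (Posz (p ^ (n + e)) %| C * r)%Z ->
    (Posz (p ^ n) %| r)%Z.
Proof.
move=> pP C0; exists (logn p `|C|) => n r.
rewrite !dvdzE abszM /=.
have Cpos : (0 < `|C|)%N by rewrite absz_gt0.
have [->|r0] := posnP `|r|; first by rewrite dvdn0.
by rewrite !pfactor_dvdn ?muln_gt0 ?Cpos // lognM // addnC leq_add2l.
Qed.

Lemma int_div_dvdz (m : int) (d : nat) : (0 < d)%N ->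
  ((m%:~R / d%:R : rat) \is a Num.int) = (d %| m)%Z.
Proof.
move=> d0; apply/idP/idP => [/intrP[k e]|/(@Qint_dvdz _ d) //].
apply/dvdzP; exists k; apply: (@intr_inj rat).
by rewrite rmorphM /= -pmulrn -e mulfVK // pnatr_eq0 -lt0n.
Qed.

Lemma padic_cong_form (p : nat) (p_pr : prime p) (n : nat) (c0 c1 c2 c3 : int)
    (f0 f1 f2 f3 : padic_int p_pr) :
  padic_cong n (c0%:~R * f0 ^+ 2 - c1%:~R * f1 ^+ 2 - c2%:~R * f2 ^+ 2
      + c3%:~R * f3 ^+ 2)
    (c0 * (f0 n) ^+ 2 - c1 * (f1 n) ^+ 2 - c2 * (f2 n) ^+ 2 + c3 * (f3 n) ^+ 2).
Proof.
have term c (f : padic_int p_pr) : padic_cong n (c%:~R * f ^+ 2) (c * (f n) ^+ 2).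
  apply: padic_congM; first exact: padic_cong_int.
  by apply: padic_congM; exact: padic_cong_res.
apply: padic_congD (term _ _); apply: padic_congD; last exact/padic_congN/term.
by apply: padic_congD; [exact: term | exact/padic_congN/term].
Qed.

Section Ramification.
Variables (a b : rat) (O : set (quat a b)) (p : nat).
Hypotheses (O_max : is_maximal_order O) (p_prime : prime p).
Implicit Types x y z u : quat a b.

Let O_order : is_order O := proj1 O_max.
Local Notation J := (norm_radical O p).
Local Notation divp x := (O (p%:R^-1 *: x)).

(* An isotropic vector modulo [p] lies on a line on which the norm form has,
   by nondegeneracy, a simple root modulo [p]. *)
Lemma unramified_of_radical : (forall x, J x -> divp x) -> ~ ramified a b p.
Proof.
move=> J_triv [p_pr ram].
have [z [Oz nz Nz]] := exists_isotropic O_max p_prime.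
have [y Oy ty] : exists2 y, O y & quat_trace (z * y) / p%:R \isn't a Num.int.
  apply: contrapT => h; apply/nz/J_triv; split=> // y Oy.
  by apply: contrapT => /negP ty; apply: h; exists y.
pose w := quat_conj y; have Ow : O w by apply: (order_conj O_order).
have wE : quat_dot z w = quat_trace (z * y) by rewrite /w; quat_ring.
have /intrP[m mE] := order_norm_int O_order Oz.
have /intrP[n nE] := order_norm_int O_order Ow.
have /intrP[t tE] := order_dot_int O_order Oz Ow.
have pm : (p %| m)%Z by rewrite -int_div_dvdz ?prime_gt0 // -mE.
have pt : ~~ (p %| t)%Z.
  by rewrite -int_div_dvdz ?prime_gt0 // -tE wE.
have [k [root k1]] := padic_hensel p_pr n pm pt.
have char0 := @padic_field_char0 p p_pr.
pose F := padic p_pr.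
pose K : F := tofrac k.
pose X : quat_over a b F := quat_incl F z + K *: quat_incl F w.
have NX : quat_norm X = 0.
  rewrite quat_normD quat_normZ quat_dotZr !quat_norm_incl // quat_dot_incl //.
  rewrite mE tE nE !ratr_int -(rmorph0 (@tofrac (padic_int p_pr))) -root.
  by rewrite !rmorphD !rmorphM !rmorph_int /=; rewrite /K; ring.
(* The product of [X] with [w] is [t + 2 n k], congruent to [t] modulo [p] because the root [k] is 0
   modulo [p]. *)
have X0 : X != 0.
  apply/eqP => X0.
  have : quat_dot X (quat_incl F w) = 0 by rewrite X0; quat_ring.
  rewrite quat_dotC quat_dotDr quat_dotZr quat_dotxx quat_norm_incl // quat_dotC quat_dot_incl //.
  rewrite tE nE !ratr_int => e.
  have : t%:~R + k * (n%:~R *+ 2) = 0 :> padic_int p_pr.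
    apply/eqP; rewrite -(tofrac_eq0 (t%:~R + k * (n%:~R *+ 2))) -e.
    by rewrite rmorphD rmorphM rmorphMn !rmorph_int.
  have h : padic_cong 1 (t%:~R + k * (n%:~R + n%:~R)) (t + 0 * (n + n)).
    by do ?[apply: padic_congD | apply: padic_congM] => //; exact: padic_cong_int.
  move=> e'; move: h; rewrite -mulr2n e' => /padic_cong0.
  by rewrite expn1 mul0r addr0 (negPf pt).
have [Y [XY _]] := ram X X0.
by have := quat_norm_neq0 XY; rewrite NX eqxx.
Qed.

(** A zero of the norm over [Q_p] is approximated by a quaternion with integer coordinates whose
    norm is highly divisible by [p]. By [norm_divpX] these coordinates are then too divisible by [p]
    to approximate a nonzero vector. *)
Lemma ramified_of_radical x0 : J x0 -> ~ divp x0 -> ramified a b p.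
Proof.
move=> Jx0 x0_prim; exists p_prime => X X0.
apply: quat_unit; apply: contraNneq X0 => NX.
have char0 := @padic_field_char0 p p_prime.
have tofrac_int c : (c%:~R : padic p_prime) = tofrac (c%:~R : padic_int p_prime).
  by rewrite rmorph_int.
have [n0 [d0 [d0z e0]]] := fraction_num_den (quat0 X).
have [n1 [d1 [d1z e1]]] := fraction_num_den (quat1 X).
have [n2 [d2 [d2z e2]]] := fraction_num_den (quat2 X).
have [n3 [d3 [d3z e3]]] := fraction_num_den (quat3 X).
(* The coordinates of [X] multiplied by the common denominator [d0 d1 d2 d3]. *)
pose f0 := n0 * (d1 * d2 * d3); pose f1 := n1 * (d0 * d2 * d3).
pose f2 := n2 * (d0 * d1 * d3); pose f3 := n3 * (d0 * d1 * d2).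
pose A := numq a; pose A' := denq a; pose B := numq b; pose B' := denq b.
have form0 : (A' * B')%:~R * f0 ^+ 2 - (A * B')%:~R * f1 ^+ 2
   - (B * A')%:~R * f2 ^+ 2 + (A * B)%:~R * f3 ^+ 2 = 0.
  apply/eqP; rewrite -tofrac_eq0; apply/eqP.
  rewrite !(rmorphD, rmorphN, rmorphM, rmorphXn) /= -!tofrac_int.
  rewrite -e0 -e1 -e2 -e3 -!(ratr_frac char0).
  transitivity ((denq a)%:~R * (denq b)%:~R * (tofrac d0 * tofrac d1 * tofrac d2 * tofrac d3) ^+ 2
     * quat_norm X); last by rewrite NX mulr0.
  by rewrite /quat_norm /A' /B'; ring.
apply/negPn/negP => X0.
have [f fi f_neq0] : exists2 f, f \in [:: f0; f1; f2; f3] & f != 0.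
  apply: contrapT => h; case/eqP: X0.
  have f_0 f : f \in [:: f0; f1; f2; f3] -> f = 0.
    by move=> fin; apply/eqP; apply: contrapT => /negP ?; apply: h; exists f.
  have c0 (x : padic p_prime) n d d' : d != 0 -> d' != 0 -> x * tofrac d = tofrac n -> n * d' = 0 -> x = 0.
    move=> dz dz' e /eqP; rewrite mulf_eq0 (negPf dz') orbF => /eqP n_0.
    by move/eqP: e; rewrite n_0 rmorph0 mulf_eq0 tofrac_eq0 (negPf dz) orbF => /eqP.
  case: X {NX} e0 e1 e2 e3 => x1 x2 x3 x4 /= e0 e1 e2 e3.
  have -> : x1 = 0.
    by apply: (c0 _ n0 d0 (d1 * d2 * d3)) => //; [rewrite !mulf_neq0 | apply: f_0; rewrite !inE eqxx ?orbT].
  have -> : x2 = 0.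
    by apply: (c0 _ n1 d1 (d0 * d2 * d3)) => //; [rewrite !mulf_neq0 | apply: f_0; rewrite !inE eqxx ?orbT].
  have -> : x3 = 0.
    by apply: (c0 _ n2 d2 (d0 * d1 * d3)) => //; [rewrite !mulf_neq0 | apply: f_0; rewrite !inE eqxx ?orbT].
  have -> : x4 = 0.
    by apply: (c0 _ n3 d3 (d0 * d1 * d2)) => //; [rewrite !mulf_neq0 | apply: f_0; rewrite !inE eqxx ?orbT].
  by [].
have [k0 k0P] := padic_neq0 f_neq0.
have [c c_gt0 cP] := order_denominator O_order.
have [m m_gt0 mP] := order_multiple O_order.
have A'B'0 : A' * B' != 0 by rewrite mulf_neq0 ?denq_neq0.
have [e eP] := prime_power_absorb p_prime A'B'0.
have cm0 : Posz (c * m) != 0 by rewrite -lt0n muln_gt0 c_gt0.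
have [e' e'P] := prime_power_absorb p_prime cm0.
(* [e] pays for the denominators of [a] and [b], [e'] for the passage into [O] and back to
   coordinates; [p ^ k0] is the power that some coordinate must avoid. Starting [N] with [k0]
   matches the form of [padic_neq0]. *)
pose j := (k0 + e')%N; pose N := (k0 + (2 * j + e))%N.
have normE (m' E0 E1 E2 E3 : int) : (A' * B')%:~R *
    quat_norm (m'%:~R *: Quat E0%:~R E1%:~R E2%:~R E3%:~R : quat a b) =
    (m' ^+ 2 * ((A' * B') * E0 ^+ 2 - (A * B') * E1 ^+ 2 - (B * A') * E2 ^+ 2
      + (A * B) * E3 ^+ 2))%:~R.
  rewrite /quat_norm !(rmorphD, rmorphN, rmorphM, rmorphXn) /= /A /A' /B /B'.
  by rewrite !numqE; ring.
pose E0 := f0 N; pose E1 := f1 N; pose E2 := f2 N; pose E3 := f3 N.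
pose Q := (A' * B') * E0 ^+ 2 - (A * B') * E1 ^+ 2 - (B * A') * E2 ^+ 2 + (A * B) * E3 ^+ 2.
have pQ : (Posz (p ^ N) %| Q)%Z.
  apply: (@padic_cong0 p p_prime).
  have := padic_cong_form N (A' * B') (A * B') (B * A') (A * B) f0 f1 f2 f3.
  by rewrite form0.
pose Xq : quat a b := Quat E0%:~R E1%:~R E2%:~R E3%:~R.
have OY : O (m%:R *: Xq) by apply: mP; split; apply: intr_int.
have /intrP[r rE] := order_norm_int O_order OY.
have A'B'r : A' * B' * r = (Posz m) ^+ 2 * Q.
  apply: (@intr_inj rat); rewrite intrM -rE.
  exact: (normE m E0 E1 E2 E3).
have pr : (Posz (p ^ (2 * j)) %| r)%Z.
  apply: eP; rewrite A'B'r; apply: dvdz_mull; apply: dvdz_trans pQ.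
  by rewrite dvdzE /= dvdn_exp2l // leq_addl.
have Oj : O (p%:R^-1 ^+ j *: (m%:R *: Xq)).
  apply: (norm_divpX O_max p_prime Jx0 x0_prim) => //.
  by rewrite rE -natrX int_div_dvdz // expn_gt0 prime_gt0.
have coord E : (c%:R * (p%:R^-1 ^+ j * (m%:R * E%:~R)) : rat) \is a Num.int ->
    (Posz (p ^ k0) %| E)%Z.
  move=> ci; apply: e'P; rewrite -int_div_dvdz ?expn_gt0 ?prime_gt0 //.
  rewrite rmorphM /= -pmulrn natrM natrX -/j; move: ci; congr (_ \is a Num.int).
  by rewrite exprVn; ring.
have [i0 i1 i2 i3] := cP _ Oj.
have := k0P (2 * j + e)%N.
by move: fi; rewrite !inE => /or4P[] /eqP ->; rewrite coord.
Qed.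
End Ramification.

(** * The different *)

Lemma has_index_refl (V : zmodType) (G : set V) : G 0 -> has_index G G 1.
Proof.
move=> G0; exists unit, (fun=> 0); split; last exact: card_unit.
by split=> [//|[] []|x Gx]; [|exists tt; rewrite subr0].
Qed.

Lemma has_index1 (V : zmodType) (G H : set V) : zmod_closed (mem H) -> G 0 ->
  has_index G H 1 -> G `<=` H.
Proof.
move=> cH G0 [T [r [[_ _ rP] eT]]] x Gx.
have [t Ht] := rP x Gx; have [s Hs] := rP 0 G0.
have ts : s = t by apply: (fintype_le1P _); rewrite eT.
move: Hs; rewrite ts sub0r => Hs; rewrite -[x](subrK (r t)) -[r t in X in _ + X]opprK.
exact: zmod_closed_sub.
Qed.

(** Translation by [x] permutes the cosets of [H]. Summing the elements [x + r t - r (s t)] of [H]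
    over all [t], the representatives cancel and [x *+ n] remains. *)
Lemma has_index_exponent (V : zmodType) (G H : set V) (n : nat) (x : V) :
  zmod_closed (mem G) -> zmod_closed (mem H) ->
  has_index G H n -> G x -> H (x *+ n).
Proof.
move=> cG cH [T [r [[Gr r_inj rP] <-]]] Gx.
have [s sP] := choice (fun t => rP (x + r t) (zmod_closed_add cG Gx (Gr t))).
have s_inj : injective s.
  move=> t t' e; apply: r_inj.
  have -> : r t - r t' = (x + r t - r (s t)) - (x + r t' - r (s t')).
    by rewrite e opprB addrA subrK opprD addrACA subrr add0r.
  exact: zmod_closed_sub.
have -> : x *+ #|T| = \sum_t (x + r t - r (s t)).
  rewrite sumrB big_split /= [X in _ - X](_ : _ = \sum_t r t); last first.
    by rewrite [RHS](reindex_inj s_inj).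
  by rewrite addrK sumr_const.
apply: (big_ind H) => [|y z|t _]; [exact: zmod_closed_zero | exact: zmod_closed_add | exact: sP].
Qed.

Lemma dvdn_squarefree (n m : nat) : (0 < n)%N ->
  (forall p, prime p -> p %| n -> ~~ (p ^ 2 %| n) && (p %| m))%N -> (n %| m)%N.
Proof.
move=> n0 h; apply/dvdn_partP => // p; rewrite mem_primes => /and3P[pP _ pn].
have /andP[p2 pm] := h p pP pn.
have -> : (n`_p = p ^ 1)%N.
  rewrite p_part; congr (_ ^ _)%N; apply/eqP; rewrite eqn_leq -pfactor_dvdn // pn andbT.
  by rewrite leqNgt -pfactor_dvdn.
by rewrite expn1.
Qed.

Section Discriminant.
Variables (a b : rat) (O : set (quat a b)).
Hypotheses (a_neq0 : a != 0) (b_neq0 : b != 0) (O_max : is_maximal_order O).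
Implicit Types (x y z : quat a b) (p q : nat).

Let O_order : is_order O := proj1 O_max.
Local Notation J p := (norm_radical O p).
Local Notation divp p x := (O (p%:R^-1 *: x)).

Lemma ramified_prime p : ramified a b p -> prime p.
Proof. by case. Qed.

Lemma ramifiedP p : prime p ->
  ramified a b p <-> exists2 x, J p x & ~ divp p x.
Proof.
move=> pP; split=> [ram|[x]]; last exact: ramified_of_radical.
apply: contrapT => h; apply: (unramified_of_radical O_max pP) ram => x Jx.
by apply: contrapT => ndx; apply: h; exists x.
Qed.

(** A discriminant bound: it shows that ramified primes are finite in number, so that [reduced_disc]
    is their actual product. *)
Lemma ramified_bounded : exists2 M : nat, (0 < M)%N &
  forall p, ramified a b p -> (p %| M)%N.
Proof.
have [m m0 mP] := order_multiple O_order.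
(* The traces of [x] against 1, [i], [j], [k] are its coordinates times [2], [2 a], [2 b],
   [- 2 a b]; the first [m] brings the basis into [O], the factor [m] added next brings the quotient
   by [p] back into [O]. *)
pose M0 : int := 2 * m%:Z * numq a * numq b.
have M0_neq0 : M0 != 0 by rewrite !mulf_neq0 ?numq_eq0 // -lt0n.
exists (m * `|M0|)%N; first by rewrite muln_gt0 m0 absz_gt0.
move=> p ram; have pP : prime p by case: ram.
have [x Jx ndx] := iffLR (ramifiedP pP) ram.
have [Ox _ tx] := Jx.
have int4 (x0 x1 x2 x3 : rat) : x0 \is a Num.int -> x1 \is a Num.int ->
  x2 \is a Num.int -> x3 \is a Num.int -> @integral_quat a b (Quat x0 x1 x2 x3) by [].
have [i0 i1] := (int_num0 rat, int_num1 rat).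
have t0 := tx _ (mP _ (int4 _ _ _ _ i1 i0 i0 i0)).
have t1 := tx _ (mP _ (int4 _ _ _ _ i0 i1 i0 i0)).
have t2 := tx _ (mP _ (int4 _ _ _ _ i0 i0 i1 i0)).
have t3 := tx _ (mP _ (int4 _ _ _ _ i0 i0 i0 i1)).
have Mx : integral_quat (p%:R^-1 *: (M0%:~R *: x)).
  rewrite /M0 !rmorphM /=.
  have hn (r : rat) : ((numq r)%:~R : rat) \is a Num.int by exact: intr_int.
  have hd (r : rat) : ((denq r)%:~R : rat) \is a Num.int by exact: intr_int.
  split.
  - have := rpredM (rpredM (hn a) (hn b)) t0; congr (_ \is a Num.int).
    by rewrite /quat_trace; case: (x) => *; rewrite /= -pmulrn; ring.
  - have := rpredM (rpredM (hd a) (hn b)) t1; congr (_ \is a Num.int).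
    by rewrite /quat_trace; case: (x) => *; rewrite /= -pmulrn (numqE a); ring.
  - have := rpredM (rpredM (hn a) (hd b)) t2; congr (_ \is a Num.int).
    by rewrite /quat_trace; case: (x) => *; rewrite /= -pmulrn (numqE b); ring.
  - have := rpredM (rpredM (hd a) (hd b)) t3; rewrite -rpredN; congr (_ \is a Num.int).
    by rewrite /quat_trace; case: (x) => *; rewrite /= -pmulrn !numqE; ring.
have := mP _ Mx.
rewrite scalerA mulrC -scalerA [m%:R *: (_ *: _)]scalerA => h.
have Mi : ((m%:R * M0%:~R : rat) \is a Num.int) by exact: rpredM (natr_int _ m) (intr_int _ M0).
have [|//] := divp_scale O_max pP Mi Ox h.
have -> : m%:R * M0%:~R = (m%:Z * M0)%:~R :> rat by rewrite intrM.
by rewrite int_div_dvdz ?prime_gt0 // dvdzE abszM.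
Qed.

Lemma reduced_disc_prod : exists s : seq nat,
  [/\ uniq s, forall p, p \in s <-> ramified a b p &
      reduced_disc a b = (\prod_(p <- s) p)%N].
Proof.
have [M M0 MP] := ramified_bounded.
have fin : finite_set [set p | ramified a b p].
  apply: (@sub_finite_set _ _ `I_M.+1); last exact: finite_II.
  by move=> p /MP /dvdn_leq; rewrite M0 => /(_ isT).
exists (finmap.enum_fset (fset_set [set p | ramified a b p])); split.
- exact: finmap.fset_uniq.
- by move=> p; rewrite in_fset_set // inE.
- by rewrite /reduced_disc fsbig_finite.
Qed.

Local Notation D := (reduced_disc a b).

Lemma reduced_disc_gt0 : (0 < D)%N.
Proof.
have [s [_ sP ->]] := reduced_disc_prod.
rewrite big_seq; apply: prodn_cond_gt0 => p /sP /ramified_prime.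
exact: prime_gt0.
Qed.

Lemma prime_dvd_prod q (s : seq nat) : prime q -> (forall p, p \in s -> prime p) ->
  (q %| \prod_(p <- s) p)%N = (q \in s).
Proof.
move=> qP; elim: s => [|p s IH] sP; first by rewrite big_nil dvdn1 gtn_eqF ?prime_gt1.
rewrite big_cons Euclid_dvdM // inE IH => [|p' p's]; last by apply: sP; rewrite inE p's orbT.
by rewrite dvdn_prime2 // sP // inE eqxx.
Qed.

Lemma ramified_dvd p : prime p -> (p %| D)%N <-> ramified a b p.
Proof.
move=> pP; have [s [_ sP ->]] := reduced_disc_prod.
by rewrite prime_dvd_prod // => p' /sP[].
Qed.

Lemma reduced_disc_squarefree p : prime p -> ~~ (p ^ 2 %| D)%N.
Proof.
move=> pP; have [s [us sP ->]] := reduced_disc_prod.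
have : forall p, p \in s -> prime p by move=> p' /sP[].
elim: s us {sP} => [|q s IH] /= => [_ _|/andP[qs us] sP].
  by rewrite big_nil dvdn1 -{2}(exp1n 2) eqn_exp2r // gtn_eqF ?prime_gt1.
have sP' p' : p' \in s -> prime p' by move=> h; apply: sP; rewrite inE h orbT.
rewrite big_cons; have qP : prime q by apply: sP; rewrite inE eqxx.
have [->|pq] := eqVneq p q; first by rewrite expnS expn1 dvdn_pmul2l ?prime_gt0 // prime_dvd_prod.
rewrite Gauss_dvdr ?IH // coprimeXl // prime_coprime //.
by rewrite dvdn_prime2.
Qed.

Lemma int_div_reduced_disc (r : rat) : r \is a Num.int ->
  (forall p, prime p -> (p %| D)%N -> r / p%:R \is a Num.int) ->
  r / D%:R \is a Num.int.
Proof.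
move=> /intrP[m ->] h; rewrite int_div_dvdz ?reduced_disc_gt0 // dvdzE /=.
apply: dvdn_squarefree reduced_disc_gt0 _ => p pP pD.
rewrite reduced_disc_squarefree //=; have := h p pP pD.
by rewrite int_div_dvdz ?prime_gt0 // dvdzE.
Qed.

Lemma int_div_prime (r : rat) p : (p %| D)%N -> prime p ->
  r / D%:R \is a Num.int -> r / p%:R \is a Num.int.
Proof.
move=> /dvdnP[k Dk] pP h.
have D0 : (D%:R : rat) != 0 by rewrite pnatr_eq0 -lt0n reduced_disc_gt0.
move: D0 h; rewrite Dk natrM mulf_eq0 negb_or => /andP[k0 p0].
have -> : r / p%:R = k%:R * (r / (k%:R * p%:R)) by field; rewrite k0 p0.
by move=> h; rewrite rpredM ?natr_int.
Qed.

Definition different_set : set (quat a b) :=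
  [set x | O x /\ quat_norm x / D%:R \is a Num.int].
Local Notation P := different_set.

Lemma different_radical p x : prime p -> (p %| D)%N -> P x -> J p x.
Proof.
move=> pP pD [Ox Nx]; have [x0 Jx0 x0P] := iffLR (ramifiedP pP) (iffLR (ramified_dvd pP) pD).
by apply: (norm_radicalP O_max pP Jx0 x0P) => //; apply: int_div_prime Nx.
Qed.

Lemma different_of_radical x : O x ->
  (forall p, prime p -> (p %| D)%N -> J p x) -> P x.
Proof.
move=> Ox h; split=> //; apply: int_div_reduced_disc.
  exact: (order_norm_int O_order).
by move=> p pP pD; have [] := h p pP pD.
Qed.

Let cO : zmod_closed (mem O). Proof. exact: zmod_closed_order. Qed.

(** The different is this intersection over the ramified primes; a list allows the index to be
    computed one prime at a time. *)
Definition radical_inter (s : seq nat) : set (quat a b) :=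
  [set x | O x /\ forall p, p \in s -> J p x].

Lemma zmod_closed_radical_inter s : (forall p, p \in s -> prime p) ->
  zmod_closed (mem (radical_inter s)).
Proof.
move=> sP; apply: zmod_closedI => [|x y [Ox xP] [Oy yP]].
  split=> [|p /sP pP]; first exact: (order0 O_order).
  exact: (zmod_closed_zero (zmod_closed_norm_radical O_max pP)).
split=> [|p ps]; first exact: (orderB O_order).
exact: (norm_radicalB O_max (xP p ps) (yP p ps)).
Qed.

Lemma norm_radical_scale p (r : rat) x : prime p -> O x -> r / p%:R \is a Num.int ->
  J p (r *: x).
Proof. by move=> pP Ox rp; apply: norm_radical_pO => //; apply: divp_mulz. Qed.

Lemma norm_radicalZ p (r : rat) x : prime p -> r \is a Num.int -> J p x -> J p (r *: x).
Proof.
move=> pP ri Jx; rewrite -mulr_algl; apply: norm_radicalMl => //.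
exact: (order_scalar O_order).
Qed.

Lemma has_index_radical_inter (s : seq nat) : uniq s ->
  (forall p, p \in s -> ramified a b p) ->
  has_index O (radical_inter s) ((\prod_(p <- s) p) ^ 2)%N.
Proof.
elim: s => [_ _|q s IH] /=.
  rewrite big_nil exp1n (_ : radical_inter [::] = O).
    by apply: has_index_refl; exact: (order0 O_order).
  by apply/seteqP; split=> x => [[]|].
move=> /andP[qs us] ram.
have rams p : p \in s -> ramified a b p by move=> h; apply: ram; rewrite inE h orbT.
have sP p : p \in s -> prime p by move=> /rams[].
have ramq : ramified a b q by apply: ram; rewrite inE eqxx.
have qP : prime q by case: ramq.
have qsP p : p \in q :: s -> prime p by move=> /ram[].
have [x0 Jx0 x0P] := iffLR (ramifiedP qP) ramq.
rewrite big_cons mulnC expnMn.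
set m := (\prod_(p <- s) p)%N in IH *.
have mi : (m%:R : rat) \is a Num.int by exact: natr_int.
have mq : (m%:R / q%:R : rat) \isn't a Num.int.
  by rewrite nat_div_int ?prime_gt0 // prime_dvd_prod.
have [t ti mt] := int_inverse_mod qP mi mq.
apply: has_indexM (IH us rams) _ => //.
- exact: zmod_closed_radical_inter.
- by move=> x [].
- by move=> x [Ox xP]; split=> // p ps; apply: xP; rewrite inE ps orbT.
have msO p x : p \in s -> O x -> J p (m%:R *: x).
  move=> ps Ox; apply: norm_radical_scale => //; first exact: sP.
  by rewrite nat_div_int ?prime_gt0 ?sP // prime_dvd_prod ?sP.
(* Chinese remainders: [m] lies in every ideal of the list [s] and is invertible modulo [q] with
   inverse [t], so multiplication by [m] carries [O / J q] onto the next step of the chain. *)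
apply: (@has_index_transfer _ O (J q) _ _ ( *:%R m%:R)) => //.
- by move=> x y; rewrite scalerBr.
- by move=> x Ox; split=> [|p ps]; [exact: (orderZ O_order) | exact: msO].
- by move=> x y; exact: (orderB O_order).
- move=> x Ox; split=> [[_ /(_ q)]|Jx].
    rewrite inE eqxx => /(_ isT) Jmx.
    have -> : x = t *: (m%:R *: x) - (m%:R * t - 1) *: x by quat_ring.
    by apply: norm_radicalB => //; [apply: norm_radicalZ | apply: norm_radical_scale].
  split=> [|p]; first exact: (orderZ O_order).
  by rewrite inE => /predU1P[->|ps]; [apply: norm_radicalZ | apply: msO].
- move=> y [Oy yP]; exists (t *: y); first exact: (orderZ O_order).
  have -> : y - m%:R *: (t *: y) = - (m%:R * t - 1) *: y by quat_ring.
  have mti : - (m%:R * t - 1) \is a Num.int by rewrite rpredN rpredB // rpredM.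
  split=> [|p]; first exact: (orderZ O_order).
  rewrite inE => /predU1P[->|ps].
    by apply: norm_radical_scale => //; rewrite mulNr rpredN.
  by apply: norm_radicalZ; [exact: sP | | exact: yP].
- exact: zmod_closed_radical_inter.
- exact: has_index_norm_radical Jx0 x0P.
Qed.

Lemma different_inter s : (forall p, p \in s <-> ramified a b p) ->
  P = radical_inter s.
Proof.
move=> sP; apply/seteqP; split=> x.
  move=> Px; split=> [|p /sP ram]; first by case: Px.
  have pP : prime p by case: ram.
  by apply: different_radical => //; apply/ramified_dvd.
by move=> [Ox xP]; apply: different_of_radical => // p pP /(ramified_dvd pP) /sP/xP.
Qed.

Lemma zmod_closed_different : zmod_closed (mem P).
Proof.
have [s [_ sP _]] := reduced_disc_prod; rewrite (different_inter sP).
by apply: zmod_closed_radical_inter => p /sP[].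
Qed.

Lemma has_index_different : has_index O P (D ^ 2).
Proof.
have [s [us sP eD]] := reduced_disc_prod.
rewrite (different_inter sP) eD; apply: has_index_radical_inter => // p.
by move=> /sP.
Qed.

Lemma different_right_ideal : right_ideal O P.
Proof.
split; [by move=> x [] | exact: zmod_closed_different |].
move=> x y Px Oy; have [Ox _] := Px.
apply: different_of_radical => [|p pP pD]; first exact: (orderM O_order).
by apply: norm_radicalMr => //; apply: different_radical.
Qed.

(** Equal indices reduce the claim to [I] being contained in [P]. Suppose [D = p m] and [x] in [I]
    has norm prime to [p]. Then [I] contains [N x] and [D ^ 2], hence [m ^ 2], so [D ^ 2] divides
    the index [m ^ 8] of [m ^ 2 O]; but [p] does not divide [m]. *)
Lemma right_ideal_different I : right_ideal O I -> has_index O I (D ^ 2) -> I = P.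
Proof.
move=> [IO cI IM] II.
have I1 (n : nat) x : I (n%:R) -> O x -> I (n%:R *: x).
  by move=> In Ox; rewrite -mulr_algl scaler_nat; apply: IM.
have ID : I ((D ^ 2)%N%:R).
  exact: (has_index_exponent cO cI II (order1 O_order)).
have IP : I `<=` P.
  move=> x Ix; have Ox := IO _ Ix.
  apply: different_of_radical => // p pP pD.
  have [x0 Jx0 x0P] := iffLR (ramifiedP pP) (iffLR (ramified_dvd pP) pD).
  apply: (norm_radicalP O_max pP Jx0 x0P) => //.
  apply: contrapT => /negP Nx; have Ni := order_norm_int O_order Ox.
  have /intrP[n nE] := Ni.
  have IN : I (n%:~R).
    have := IM x _ Ix (order_conj O_order Ox); rewrite quat_normE nE.
    by rewrite scaler_int.
  have [m Dm] := dvdnP pD.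
  have pm : ~~ (p %| m)%N.
    apply: contra (reduced_disc_squarefree pP) => pm.
    by rewrite Dm expnS expn1 dvdn_mul.
  have cop : coprimez n ((p ^ 2)%N : int).
    rewrite coprimezE coprime_sym coprimeXl // prime_coprime //.
    by apply: contra Nx; rewrite nE int_div_dvdz ?prime_gt0 // dvdzE.
  have [u [v uv]] := Bezoutz n (p ^ 2)%N.
  have Im : I ((m ^ 2)%N%:R).
    have e : (m ^ 2)%N%:Z = (u * (m ^ 2)%N%:Z) * n + v * (D ^ 2)%N%:Z.
      rewrite Dm expnMn mulnC PoszM mulrCA mulrA -mulrA [X in _ = X](_ : _ = (u * n + v * (p ^ 2)%N) * (m ^ 2)%N%:Z).
        by rewrite uv (eqP cop) mul1r.
      by ring.
    have mulI (k l : int) : I (l%:~R) -> I ((k * l)%:~R).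
      move=> Il; rewrite mulrC intrM; apply: IM => //.
      case: k => k; first exact: (order_nat O_order).
      by rewrite NegzE mulrNz; apply: (orderN O_order); apply: (order_nat O_order).
    rewrite pmulrn e intrD; apply: zmod_closed_add => //; apply: mulI => //.
  have m0 : (0 < m ^ 2)%N.
    by rewrite expn_gt0; case: m {pm Im uv} Dm reduced_disc_gt0 => // ->.
  have Im' : has_index O [set x | O ((m ^ 2)%N%:R^-1 *: x)] ((m ^ 2) ^ 4)%N.
    exact: has_index_order_scale.
  have mI : [set x | O ((m ^ 2)%N%:R^-1 *: x)] `<=` I.
    move=> y /(I1 _ _ Im); rewrite scalerA divff ?scale1r //.
    by rewrite pnatr_eq0 -lt0n.
  have cmO : zmod_closed (mem [set x | O ((m ^ 2)%N%:R^-1 *: x)]).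
    exact: zmod_closed_order_scale.
  have [k Ik] := has_index_sub IO mI cmO Im'.
  have := has_index_unique cmO Im' (has_indexM cO cI IO mI II Ik).
  move=> /(congr1 (dvdn p)); rewrite -expnM Euclid_dvdX // (negPf pm) /=.
  by rewrite Dm expnMn -mulnA [(p ^ 2 * k)%N]mulnC !mulnA dvdn_mull // dvdn_exp.
apply/seteqP; split=> //.
have PO : P `<=` O by move=> x [].
have [k Ik] := has_index_sub PO IP cI II.
have := has_index_unique cI II (has_indexM cO zmod_closed_different PO IP has_index_different Ik).
move=> /eqP; rewrite -{1}[(D ^ 2)%N]muln1 eqn_pmul2l ?expn_gt0 ?reduced_disc_gt0 //.
move=> /eqP k1; rewrite -k1 in Ik.
by apply: has_index1 Ik => //; apply: zmod_closed_zero zmod_closed_different.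
Qed.

Lemma different_unique : is_different O P.
Proof.
have O0 := order0 O_order.
split.
  split; first exact: different_right_ideal.
  by apply/(has_index_card _ zmod_closed_different O0)/has_index_different.
move=> I [rI cI]; apply/esym/right_ideal_different => //.
by apply/has_index_card => //; case: rI.
Qed.

(** If [J] were [p O], [N z] would be prime to [p]; testing on [conj z * u] then makes every trace
    divisible by [p], and an isotropic vector would lie in [J]. *)
Lemma ramified_of_trace p z : prime p -> O z -> ~ divp p z ->
  (forall y, O y -> quat_trace (z * y) / p%:R \is a Num.int) -> ramified a b p.
Proof.
move=> pP Oz ndz tz; apply/(ramifiedP pP); apply: contrapT => h.
have triv x : J p x -> divp p x.
  by move=> Jx; apply: contrapT => ndx; apply: h; exists x.
have [Nz|Nz] := boolP (quat_norm z / p%:R \is a Num.int).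
  by apply: ndz; apply: triv.
have tr_p u : O u -> quat_trace u / p%:R \is a Num.int.
  move=> Ou; have Ozu : O (quat_conj z * u).
    by apply: (orderM O_order) => //; apply: (order_conj O_order).
  have := tz _ Ozu; rewrite mulrA quat_normE mulr_algl quat_traceZ.
  move=> /(Gauss_int pP (order_norm_int O_order Oz) (order_trace_int O_order Ou)).
  by case=> //; rewrite (negPf Nz).
have [v [Ov ndv Nv]] := exists_isotropic O_max pP.
apply: ndv; apply: triv; split=> // y Oy.
exact/tr_p/(orderM O_order).
Qed.

(** Let [n] be the least positive integer with [z = n y] in [O]. At a prime [q] dividing [n], [z] is
    not in [q O] but has all traces divisible by [q], so [q] is ramified; [divp_of_trace2] excludes
    [q ^ 2]. Thus [n] divides [D], and each prime of [D] divides either [D / n] or the traces of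
    [z]. *)
Lemma dual_different y :
  (forall x, O x -> quat_trace (y * x) \is a Num.int) -> P (D%:R *: y).
Proof.
move=> ty; have [_ _ Om] := O_order.
have ex : exists n, (0 < n)%N && `[< O (n%:R *: y) >].
  have [m [m0 Omy]] := Om y; exists m; rewrite m0; apply/asboolP.
  by rewrite scaler_nat.
pose n := ex_minn ex.
have [/andP[n0 /asboolP On] n_min] : (0 < n)%N && `[< O (n%:R *: y) >] /\
   forall m, (0 < m)%N && `[< O (m%:R *: y) >] -> (n <= m)%N by rewrite /n; case: ex_minnP.
clearbody n; pose z := n%:R *: y.
have nr : (n%:R : rat) != 0 by rewrite pnatr_eq0 -lt0n.
have ndz q : prime q -> (q %| n)%N -> ~ divp q z.
  move=> qP /dvdnP[k nk]; rewrite /z scalerA nk natrM mulrC mulfK ?pnatr_eq0 -?lt0n ?prime_gt0 // => Ok.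
  have k0 : (0 < k)%N by case: k nk Ok n0 => // ->.
  have := n_min k; rewrite k0 => /(_ (asboolT Ok)).
  by rewrite nk leqNgt ltn_Pmulr ?prime_gt1.
have tz (d : nat) x : (d %| n)%N -> O x -> quat_trace (z * x) / d%:R \is a Num.int.
  move=> dn Ox; rewrite /z -scalerAl quat_traceZ mulrAC rpredM ?ty //.
  by rewrite nat_div_int // (dvdn_gt0 n0).
have ramn q : prime q -> (q %| n)%N -> ramified a b q.
  move=> qP qn; apply: (ramified_of_trace qP On (ndz q qP qn)) => x; exact: tz.
have nD : (n %| D)%N.
  apply: dvdn_squarefree => // q qP qn; apply/andP; split; last exact/ramified_dvd/ramn.
  apply/negP => q2n; have [x0 Jx0 x0P] := iffLR (ramifiedP qP) (ramn q qP qn).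
  apply: (ndz q qP qn); apply: (divp_of_trace2 O_max qP Jx0 x0P) => // x Ox.
  by rewrite -natrX tz.
have [k Dk] := dvdnP nD.
have DE : D%:R *: y = k%:R *: z by rewrite /z scalerA Dk natrM.
have OD : O (D%:R *: y) by rewrite DE; apply: (orderZ O_order) => //; apply: natr_int.
apply: different_of_radical => // p pP pD.
have [x0 Jx0 x0P] := iffLR (ramifiedP pP) (iffLR (ramified_dvd pP) pD).
rewrite DE; move: pD; rewrite Dk Euclid_dvdM // => /orP[pk|pn].
  by apply: norm_radical_scale; rewrite ?nat_div_int ?prime_gt0.
apply: norm_radicalZ; rewrite ?natr_int //.
by apply: (norm_radical_of_trace O_max pP Jx0 x0P) => // x; apply: tz.
Qed.
End Discriminant.

(** * Hermite reduction and discriminants 1 and 2 *)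

Section PositiveNorm.
Variables (K : realFieldType) (a b : K).
Hypotheses (a_lt0 : a < 0) (b_lt0 : b < 0).
Implicit Types x : quat a b.

Lemma quat_norm_pos x : quat_norm x = quat0 x ^+ 2 + (- a) * quat1 x ^+ 2
  + (- b) * quat2 x ^+ 2 + (a * b) * quat3 x ^+ 2.
Proof. by rewrite /quat_norm; ring. Qed.

Lemma quat_norm_ge0 x : 0 <= quat_norm x.
Proof.
have ab0 : 0 < a * b by rewrite nmulr_rgt0.
have [a0 b0] : 0 < - a /\ 0 < - b by rewrite !oppr_gt0.
have sq (c r : K) : 0 < c -> 0 <= c * r ^+ 2 by move=> c0; rewrite mulr_ge0 ?sqr_ge0 ?ltW.
by rewrite quat_norm_pos !addr_ge0 ?sqr_ge0 ?sq.
Qed.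

Lemma quat_norm_eq0 x : (quat_norm x == 0) = (x == 0).
Proof.
apply/eqP/eqP => [|->]; last by rewrite /quat_norm /= !expr0n /= !mulr0 !subr0 addr0.
have ab0 : 0 < a * b by rewrite nmulr_rgt0.
have [a0 b0] : 0 < - a /\ 0 < - b by rewrite !oppr_gt0.
have sq (c r : K) : 0 < c -> 0 <= c * r ^+ 2 by move=> c0; rewrite mulr_ge0 ?sqr_ge0 ?ltW.
have sq0 (c r : K) : 0 < c -> c * r ^+ 2 = 0 -> r = 0.
  by move=> c0 /eqP; rewrite mulf_eq0 gt_eqF //= sqrf_eq0 => /eqP.
case: x => x0 x1 x2 x3; rewrite quat_norm_pos /= => e.
have [h0 h1 h2 h3] : [/\ 0 <= x0 ^+ 2, 0 <= - a * x1 ^+ 2, 0 <= - b * x2 ^+ 2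
   & 0 <= a * b * x3 ^+ 2] by split; rewrite ?sqr_ge0 ?sq.
have -> : x0 = 0 by apply/eqP; rewrite -sqrf_eq0; apply/eqP; lra.
have -> : x1 = 0 by apply: (sq0 (- a)) => //; lra.
have -> : x2 = 0 by apply: (sq0 (- b)) => //; lra.
have -> : x3 = 0 by apply: (sq0 (a * b)) => //; lra.
by [].
Qed.

Lemma quat_norm_gt0 x : x != 0 -> 0 < quat_norm x.
Proof. by rewrite lt_def quat_norm_ge0 quat_norm_eq0 andbT. Qed.
End PositiveNorm.

(** If [a] is positive with square root [s], then [(i - s) (i + s) = 0], but Hamilton's quaternions
    have no zero divisors; likewise for [b] and [j]. *)
Lemma definite_neg (R : realType) (a b : rat) : a != 0 -> b != 0 ->
  definite R a b -> a < 0 /\ b < 0.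
Proof.
move=> a0 b0 [f /bij_inj f_inj].
have m1 : (-1 : R) < 0 by rewrite oppr_lt0.
have noZD (x y : quat (ratr a : R) (ratr b : R)) : x * y = 0 -> x = 0 \/ y = 0.
  move=> xy; have : quat_norm (f x) * quat_norm (f y) = 0.
    rewrite -quat_normM -rmorphM xy rmorph0; apply/eqP.
    by rewrite quat_norm_eq0.
  move=> /eqP; rewrite mulf_eq0 !quat_norm_eq0 // => /orP[] /eqP e; [left|right];
    by apply: f_inj; rewrite rmorph0.
split; rewrite ltNge le_eqVlt eq_sym ?(negPf a0) ?(negPf b0) /=; apply/negP => h.
- pose s := Num.sqrt (ratr a : R).
  have ss : s ^+ 2 = ratr a by rewrite sqr_sqrtr // ler0q ltW.
  have : (Quat (- s) 1 0 0 : quat (ratr a : R) (ratr b : R)) * Quat s 1 0 0 = 0.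
    by congr Quat => /=; rewrite -?ss; ring.
  by move=> /noZD[] [_ /eqP]; rewrite oner_eq0.
- pose s := Num.sqrt (ratr b : R).
  have ss : s ^+ 2 = ratr b by rewrite sqr_sqrtr // ler0q ltW.
  have : (Quat (- s) 0 1 0 : quat (ratr a : R) (ratr b : R)) * Quat s 0 1 0 = 0.
    by congr Quat => /=; rewrite -?ss; ring.
  by move=> /noZD[] [_ /eqP]; rewrite oner_eq0.
Qed.

Lemma nearest_int (B L : rat) : L != 0 ->
  exists2 k : rat, k \is a Num.int & `|B + k * L| <= `|L| / 2.
Proof.
move=> L0; exists (- (Num.floor (B / L + 1 / 2))%:~R); first by rewrite rpredN intr_int.
have := floor_le (B / L + 1 / 2); have := floorD1_gt (B / L + 1 / 2).
move: (Num.floor _) => t; rewrite intrD => h1 h2.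
have -> : B + - t%:~R * L = (B / L - t%:~R) * L by field.
rewrite normrM mulrC; apply: ler_wpM2l; first exact: normr_ge0.
by rewrite ler_norml; apply/andP; split; lra.
Qed.

Lemma nearest_int_double (B M : rat) : 0 < M ->
  exists2 k : rat, k \is a Num.int & (B + k * (2 * M)) ^+ 2 <= M ^+ 2.
Proof.
move=> M0; have M2 : 0 < 2 * M by rewrite mulr_gt0.
have [k ki kB] := @nearest_int B (2 * M) (lt0r_neq0 M2).
exists k => //; rewrite -[X in X <= _]real_normK ?num_real //.
rewrite lerXn2r ?nnegrE ?normr_ge0 ?(ltW M0) //; apply: le_trans kB _.
by rewrite (gtr0_norm M2) mulrAC mulfV ?mul1r.
Qed.

(** Reduction of a binary form of discriminant [- X]: with [|B| <= M <= M'], [4 M M' - B ^ 2] is at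
    least [3 M ^ 2]. Positivity of [X] forces that of [M'], so minimality among positive values
    suffices. *)
Lemma reduced_gram_bound (X M M' B : rat) : 0 < X -> 0 < M ->
  X = 4 * M * M' - B ^+ 2 -> B ^+ 2 <= M ^+ 2 -> (0 < M' -> M <= M') ->
  3 * M ^+ 2 <= X.
Proof.
move=> X0 M0 e B2 min_M; have M4 : 0 < 4 * M by rewrite mulr_gt0.
have : 0 < 4 * M * M' by have := sqr_ge0 B; lra.
rewrite pmulr_rgt0 // => /min_M; rewrite -(ler_pM2l M4) -mulrA -expr2; lra.
Qed.

(** The chain is [N / G <= M / (3 N) <= 16 / (9 M) <= 16 / 27]. *)
Lemma small_dual_bound (N G M : rat) : 0 < N -> 0 < G -> 3 <= M ->
  3 * M ^+ 2 <= 16 * N -> 3 * N ^+ 2 <= G * M -> 27 * (G^-1 * N) <= 16.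
Proof.
move=> N0 G0 M3 MN NG; have M0 : 0 < M by lra.
rewrite mulrCA (ler_pdivrMl _ _ G0) -(ler_pM2r M0).
have h1 : N * (3 * M ^+ 2) <= N * (16 * N) by rewrite ler_pM2l.
have h2 : 9 * (N * M) * 3 <= 9 * (N * M) * M by rewrite ler_pM2l ?mulr_gt0.
have e1 : N * (3 * M ^+ 2) = 3 * (N * M * M) by ring.
have e2 : N * (16 * N) = 16 * N ^+ 2 by ring.
by rewrite e1 e2 in h1; lra.
Qed.

Section Reduction.
Variables (a b : rat) (O : set (quat a b)).
Hypotheses (a_lt0 : a < 0) (b_lt0 : b < 0) (O_order : is_order O).
Implicit Types x y z u v w : quat a b.

Lemma exists_min_value (f : quat a b -> rat) :
  (forall x, O x -> f x \is a Num.int) -> (exists2 x, O x & 0 < f x) ->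
  exists x, [/\ O x, 0 < f x & forall y, O y -> 0 < f y -> f x <= f y].
Proof.
move=> fi [x0 Ox0 fx0].
pose Q (n : nat) := `[< exists x, [/\ O x, 0 < f x & f x = n%:R] >].
have fn x : O x -> 0 < f x -> exists n : nat, f x = n%:R.
  move=> Ox fx; have := fi x Ox; rewrite intrEge0 ?ltW // => /natrP[n ->].
  by exists n.
have ex : exists n, Q n.
  by have [n fxn] := fn _ Ox0 fx0; exists n; apply/asboolP; exists x0.
case: (ex_minnP ex) => n /asboolP[x [Ox fx fxn]] n_min; exists x; split=> // y Oy fy.
have [m fym] := fn y Oy fy; rewrite fxn fym ler_nat; apply: n_min.
by apply/asboolP; exists y.
Qed.

(** The norm of [2 x - tr x], that is four times the norm of the projection of [x] orthogonal to
    1. *)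
Definition quat_pure_disc x := 4 * quat_norm x - quat_trace x ^+ 2.
Local Notation Delta := quat_pure_disc.
Local Notation com x y := (x * y - y * x).

(** Lagrange's identity: the commutator is twice the cross product of the pure parts. *)
Lemma pure_disc_com u v : 16 * quat_norm (com u v) =
  4 * Delta u * Delta v - quat_dot (2 *: u - (quat_trace u)%:A) (2 *: v - (quat_trace v)%:A) ^+ 2.
Proof. rewrite /Delta; quat_ring. Qed.

(** Lagrange's identity for the two cross products, combined with
    [(u x v) x (u x w) = det (u, v, w) u] on pure parts. *)
Lemma pure_disc_triple u v w : quat_dot w (com u v) ^+ 2 * Delta u =
  4 * quat_norm (com u v) * quat_norm (com u w) - quat_dot (com u v) (com u w) ^+ 2.
Proof. rewrite /Delta; quat_ring. Qed.

(** [4 m - t ^ 2] is 0 or 3 modulo 4. *)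
Lemma pure_disc_ge3 x : O x -> 0 < Delta x -> 3 <= Delta x.
Proof.
move=> Ox; rewrite /Delta.
have /intrP[m ->] := order_norm_int O_order Ox.
have /intrP[t ->] := order_trace_int O_order Ox.
have -> : 4 * m%:~R - t%:~R ^+ 2 = (4 * m - t ^+ 2)%:~R :> rat.
  by rewrite rmorphB rmorphM rmorphXn.
rewrite ltr0z -[3]/(3%:~R) ler_int.
have [h [e|e]] : exists h : int, t = 2 * h \/ t = 2 * h + 1.
  by exists (t %/ 2)%Z; lia.
- have -> : t ^+ 2 = 4 * h ^+ 2 by rewrite e; ring.
  by move: (h ^+ 2) => h2; lia.
- have -> : t ^+ 2 = 4 * (h ^+ 2 + h) + 1 by rewrite e; ring.
  by move: (h ^+ 2 + h) => h2; lia.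
Qed.

Let norm_eq0 := quat_norm_eq0 a_lt0 b_lt0.
Let norm_gt0 := quat_norm_gt0 a_lt0 b_lt0.

Lemma exists_pure_disc_gt0 : exists2 x, O x & 0 < Delta x.
Proof.
have [m m0 mP] := order_multiple O_order.
exists (m%:R *: Quat 0 1 0 0); first by apply: mP; split; rewrite ?rpred0 ?rpred1.
have -> : Delta (m%:R *: (Quat 0 1 0 0 : quat a b)) = 4 * m%:R ^+ 2 * (- a).
  by rewrite /Delta; quat_ring.
by rewrite !mulr_gt0 ?exprn_gt0 ?ltr0n ?oppr_gt0.
Qed.

(** Otherwise [u] would commute with multiples of [i] and [j], hence be rational, with
    [Delta u = 0]. *)
Lemma exists_com_gt0 u : 0 < Delta u -> exists2 v, O v & 0 < quat_norm (com u v).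
Proof.
move=> Du; apply: contrapT => h.
have com0 v : O v -> com u v = 0.
  move=> Ov; apply/eqP; rewrite -norm_eq0; apply: contraT => ne.
  by case: h; exists v => //; apply: norm_gt0; rewrite -norm_eq0.
have [m m0 mP] := order_multiple O_order.
have mr : (m%:R : rat) != 0 by rewrite pnatr_eq0 -lt0n.
have ei : integral_quat (Quat 0 1 0 0 : quat a b) by split; rewrite ?rpred0 ?rpred1.
have ej : integral_quat (Quat 0 0 1 0 : quat a b) by split; rewrite ?rpred0 ?rpred1.
have := com0 _ (mP _ ei); have := com0 _ (mP _ ej).
move: Du {com0 h}; rewrite /Delta; case: u => u0 u1 u2 u3 Du [_ _ _ /eqP e1] [_ _ /eqP e2 /eqP e3].
have a0 := lt_eqF a_lt0.
have two0 : (2 : rat) != 0 by [].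
have u1_0 : u1 = 0.
  apply/eqP; move: e1.
  rewrite (_ : _ - _ = 2 * m%:R * u1); last by rewrite /=; ring.
  by rewrite !mulf_eq0 (negPf mr).
have u2_0 : u2 = 0.
  apply/eqP; move: e3.
  rewrite (_ : _ - _ = - (2 * m%:R * u2)); last by rewrite /=; ring.
  by rewrite oppr_eq0 !mulf_eq0 (negPf mr).
have u3_0 : u3 = 0.
  apply/eqP; move: e2.
  rewrite (_ : _ - _ = - (2 * m%:R * a * u3)); last by rewrite /=; ring.
  by rewrite oppr_eq0 !mulf_eq0 (negPf mr) a0.
move: Du; rewrite /quat_norm /quat_trace /= u1_0 u2_0 u3_0.
by rewrite (_ : _ - _ = 0) ?ltxx //; ring.
Qed.

(* Hermite reduction of the projection of [O] orthogonal to 1, read on the dual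
   side: [com u v] is orthogonal to 1, [u] and [v]. *)
Lemma exists_small_dual : exists y, [/\ y != 0, quat_trace y = 0,
  forall x, O x -> quat_trace (y * x) \is a Num.int & 27 * quat_norm y <= 16].
Proof.
have Delta_int x : O x -> Delta x \is a Num.int.
  move=> Ox; apply: rpredB; last exact/rpredX/(order_trace_int O_order).
  by apply: rpredM; [exact: (natr_int _ 4) | exact: (order_norm_int O_order)].
have [u [Ou Du u_min]] := exists_min_value Delta_int exists_pure_disc_gt0.
have Oc v : O v -> O (com u v).
  by move=> Ov; apply: (orderB O_order); apply: (orderM O_order).
have [v [Ov Nv v_min]] := exists_min_value
  (fun v Ov => order_norm_int O_order (Oc v Ov)) (exists_com_gt0 Du).
pose n := com u v; have On : O n := Oc v Ov.
have n_dot : 0 < `|quat_dot n n| by rewrite quat_dotxx normr_gt0 mulrn_eq0 /= gt_eqF.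
have fi x : O x -> `|quat_dot x n| \is a Num.int.
  by move=> Ox; rewrite intrEge0 // natr_norm_int // (order_dot_int O_order).
(* By minimality, [g] generates the group of products of [O] with [n], so [n / g] has integral
   traces against [O]. *)
have [w [Ow gw w_min]] := exists_min_value fi (ex_intro2 _ _ n On n_dot).
pose g := quat_dot w n.
have g0 : g != 0 by rewrite -normr_gt0.
have Dge3 := pure_disc_ge3 Ou Du.
(* Adding a multiple of [u] to [v] does not change [n] and makes the Gram entry small; likewise
   below, adding a multiple of [v] to [w] does not change [g]. *)
have bound1 : 3 * Delta u ^+ 2 <= 16 * quat_norm n.
  pose B := quat_dot (2 *: u - (quat_trace u)%:A) (2 *: v - (quat_trace v)%:A).
  have [k ki B2] := @nearest_int_double B (Delta u) Du.
  have := pure_disc_com u (v + k *: u).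
  have -> : com u (v + k *: u) = n by rewrite /n; quat_ring.
  have -> : quat_dot (2 *: u - (quat_trace u)%:A)
     (2 *: (v + k *: u) - (quat_trace (v + k *: u))%:A) = B + k * (2 * Delta u).
    by rewrite /B /Delta; quat_ring.
  move=> e; apply: reduced_gram_bound e B2 _; rewrite ?mulr_gt0 //.
  by apply: u_min; apply: (orderD O_order) => //; apply: (orderZ O_order).
have bound2 : 3 * quat_norm n ^+ 2 <= g ^+ 2 * Delta u.
  pose B := quat_dot n (com u w).
  have [k ki B2] := @nearest_int_double B (quat_norm n) Nv.
  have := pure_disc_triple u v (w + k *: v).
  have -> : quat_dot (w + k *: v) (com u v) = g by rewrite /g /n; quat_ring.
  have -> : quat_dot (com u v) (com u (w + k *: v)) = B + k * (2 * quat_norm n).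
    by rewrite /B /n; quat_ring.
  rewrite -/n => e; apply: reduced_gram_bound e B2 _ => //.
    by rewrite mulr_gt0 // exprn_even_gt0.
  by apply: v_min; apply: (orderD O_order) => //; apply: (orderZ O_order).
exists (g^-1 *: n); split.
- rewrite scaler_eq0 invr_eq0 (negPf g0) /= -norm_eq0.
  by rewrite gt_eqF.
- rewrite quat_traceZ (_ : quat_trace n = 0) ?mulr0 //.
  by rewrite /n; quat_ring.
- move=> x Ox; rewrite -scalerAl quat_traceZ.
  have [k ki kx] := @nearest_int (quat_dot x n) g g0.
  have e : quat_dot (x + k *: w) n = quat_dot x n + k * g.
    by rewrite quat_dotC quat_dotDr quat_dotZr quat_dotC [quat_dot n w]quat_dotC.
  have : `|quat_dot (x + k *: w) n| = 0.
    apply/eqP; apply: contraT; rewrite -normr_eq0 normr_id -normr_gt0 normr_id => h.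
    have Oxk : O (x + k *: w) by apply: (orderD O_order) => //; apply: (orderZ O_order).
    have := w_min _ Oxk h; rewrite e -/g leNgt => /negP[].
    by apply: le_lt_trans kx _; rewrite ltr_pdivrMr // ltr_pMr ?normr_gt0 // ltr1n.
  move/normr0_eq0; rewrite e => /eqP; rewrite addr_eq0 => /eqP e'.
  have -> : quat_trace (n * x) = k * g.
    rewrite -[RHS]opprK -e'; rewrite /n; quat_ring.
  by rewrite mulrC mulfK.
- rewrite quat_normZ exprVn; apply: small_dual_bound Dge3 bound1 bound2 => //.
  by rewrite exprn_even_gt0.
Qed.
End Reduction.

(** * The equivalences *)

Section Different.
Variables (a b : rat) (O : set (quat a b)).
Hypotheses (a_lt0 : a < 0) (b_lt0 : b < 0) (O_max : is_maximal_order O).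
Implicit Types (x y z : quat a b) (p q : nat).

Let O_order : is_order O := proj1 O_max.
Let a_neq0 : a != 0 := ltr0_neq0 a_lt0.
Let b_neq0 : b != 0 := ltr0_neq0 b_lt0.
Local Notation J p := (norm_radical O p).
Local Notation divp p x := (O (p%:R^-1 *: x)).
Local Notation D := (reduced_disc a b).
Local Notation P := (different_set O).

Let D_gt0 : (0 < D)%N := reduced_disc_gt0 a_neq0 b_neq0 O_max.

Lemma sqr_pure x : quat_trace x = 0 -> x ^+ 2 = - (quat_norm x)%:A.
Proof. by move=> t0; rewrite expr2 quat_sqr t0 scale0r sub0r. Qed.

Lemma different_norm x : O x -> quat_norm x = D%:R -> P x.
Proof. by move=> Ox Nx; split=> //; rewrite Nx divff ?rpred1 // pnatr_eq0 -lt0n. Qed.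

(** Since [D] is a multiple of [pi], [N pi = D m] with [m] dividing [D]. If a prime [p] divided [m],
    all norms from [P] would be divisible by [p ^ 2], but [(D / p) * x0] lies in [P] and its norm
    has only one factor [p]. *)
Lemma principal_different_norm pi : O pi -> P = [set pi * x | x in O]%classic ->
  quat_norm pi = D%:R.
Proof.
move=> Opi eP.
have Dr : (D%:R : rat) != 0 by rewrite pnatr_eq0 -lt0n.
have Ppi : P pi by rewrite eP; exists 1; rewrite ?mulr1 //; apply: (order1 O_order).
have PD : P D%:R.
  split; first exact: (order_nat O_order).
  by rewrite -scaler_nat quat_norm_scalar expr2 mulfK ?natr_int.
have [y Oy piy] : exists2 y, O y & pi * y = D%:R by move: PD; rewrite eP => -[y ? <-]; exists y.
have [_ /intrP[m mE]] := Ppi.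
have NE : quat_norm pi = D%:R * m%:~R by rewrite -mE mulrC mulfVK.
have /intrP[k kE] := order_norm_int O_order Oy.
have mk : m * k = D.
  have := congr1 (fun z => quat_norm z) piy.
  rewrite quat_normM NE kE -[in RHS]scaler_nat quat_norm_scalar expr2 -mulrA.
  by move=> /(mulfI Dr); rewrite -intrM pmulrn => /intr_inj.
have m_gt0 : 0 < m.
  have : 0 <= quat_norm pi by apply: quat_norm_ge0.
  rewrite NE pmulr_rge0 ?ltr0n // ler0z le_eqVlt => /predU1P[m0|//].
  by move: D_gt0; rewrite -ltz_nat -mk -m0 mul0r ltxx.
have [m1|m1] := eqVneq m 1; first by rewrite NE m1 mulr1.
have [p pP pm] : exists2 p, prime p & (p %| m)%Z.
  exists (pdiv `|m|); last by rewrite dvdzE pdiv_dvd.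
  by apply: pdiv_prime; lia.
have pD : (p %| D)%N.
  by have : (p %| Posz D)%Z by rewrite -mk dvdz_mulr.
have [x0 Jx0 x0P] := iffLR (ramifiedP O_max pP) (iffLR (ramified_dvd a_neq0 b_neq0 O_max pP) pD).
have [l lE] := dvdnP pD.
have pl : ~~ (p %| l)%N.
  apply: contra (reduced_disc_squarefree a_neq0 b_neq0 O_max pP) => pl.
  by rewrite lE expnS expn1 dvdn_mul.
have Ox0 : O x0 by case: Jx0.
have Pz : P (l%:R *: x0).
  apply: (different_of_radical a_neq0 b_neq0 O_max) => [|q qP].
    by apply: (orderZ O_order) => //; apply: natr_int.
  rewrite lE Euclid_dvdM // => /orP[ql|].
    by apply: norm_radical_scale; rewrite ?nat_div_int ?prime_gt0.
  rewrite dvdn_prime2 // => /eqP ->.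
  by apply: norm_radicalZ => //; apply: natr_int.
have [x Ox pix] : exists2 x, O x & pi * x = l%:R *: x0.
  by move: Pz; rewrite eP => -[x ? <-]; exists x.
have [h hE] := dvdzP pm.
case: x0P; apply: (norm_radical_primitive O_max pP) => //.
have pr : (p%:R : rat) != 0 by rewrite pnatr_eq0 -lt0n prime_gt0.
have lr : (l%:R : rat) != 0.
  by rewrite pnatr_eq0; apply: contraNneq pl => ->; rewrite dvdn0.
have := congr1 (fun z => quat_norm z) pix.
rewrite quat_normM quat_normZ NE hE lE natrM intrM -pmulrn => e.
have e' : l%:R * (quat_norm x0 / p%:R) / p%:R = h%:~R * quat_norm x.
  apply: (mulfI lr); apply: (mulfI (mulf_neq0 pr pr)).
  transitivity (l%:R ^+ 2 * quat_norm x0); last by rewrite -e; ring.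
  by field.
have [_ Nx0 _] := Jx0.
have : l%:R * (quat_norm x0 / p%:R) / p%:R \is a Num.int.
  by rewrite e'; apply: rpredM; [exact: intr_int | exact: (order_norm_int O_order)].
move=> /(Gauss_int pP (natr_int _ l) Nx0)[|]; first by rewrite nat_div_int ?prime_gt0 // (negPf pl).
by rewrite expr2 invfM mulrA.
Qed.

Lemma order_div_disc z : O z ->
  (forall p, prime p -> (p %| D)%N -> divp p z) -> O (D%:R^-1 *: z).
Proof.
move=> Oz dz; have [s [us sP ->]] := reduced_disc_prod a_neq0 b_neq0 O_max.
have : forall p, p \in s -> prime p /\ divp p z.
  move=> p /sP ram; have pP := ramified_prime ram; split=> //.
  by apply: dz => //; apply/(ramified_dvd a_neq0 b_neq0 O_max pP).
elim: s us {sP} => [_ _|q s IH /andP[qs us] sP]; first by rewrite big_nil invr1 scale1r.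
have [qP dq] := sP q (mem_head q s).
have sP' p : p \in s -> prime p /\ divp p z by move=> ps; apply: sP; rewrite inE ps orbT.
have sprime p : p \in s -> prime p by move=> /sP'[].
rewrite big_cons; set m := (\prod_(p <- s) p)%N in IH *.
have mq : (m%:R / q%:R : rat) \isn't a Num.int.
  by rewrite nat_div_int ?prime_gt0 // prime_dvd_prod.
have [t ti mt] := int_inverse_mod qP (natr_int _ m) mq.
have Om := IH us sP'.
have m0 : (m%:R : rat) != 0.
  by apply: contraNneq mq => ->; rewrite mul0r rpred0.
have q0 : (q%:R : rat) != 0 by rewrite pnatr_eq0 -lt0n prime_gt0.
(* Partial fractions for [1 / (q m)], with integral coefficients as [t] inverts [m] modulo [q]. *)
have -> : (q * m)%N%:R^-1 *: z = t *: (q%:R^-1 *: z) - ((m%:R * t - 1) / q%:R) *: (m%:R^-1 *: z).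
  by rewrite !scalerA -scalerBl natrM; congr (_ *: _); field; rewrite m0 q0.
by apply: (orderB O_order); apply: (orderZ O_order).
Qed.

Lemma norm_different_principal w : O w -> quat_norm w = D%:R ->
  P = [set w * x | x in O]%classic.
Proof.
move=> Ow Nw; have Pw := different_norm Ow Nw.
have [_ _ PM] := different_right_ideal a_neq0 b_neq0 O_max.
have Dr : (D%:R : rat) != 0 by rewrite pnatr_eq0 -lt0n.
apply/seteqP; split=> y; last by move=> [x Ox <-]; apply: PM.
move=> Py; have Oy : O y by case: Py.
(* This is [w^-1 * y]. It lies in [O] because at each prime [p] of [D] both [conj w] and [y] are in
   [J p], whose square is in [p O]. *)
exists (D%:R^-1 *: (quat_conj w * y)).
  apply: order_div_disc => [|p pP pD].
    by apply: (orderM O_order) => //; apply: (order_conj O_order).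
  apply: (norm_radicalM O_max pP); last exact: (different_radical a_neq0 b_neq0 O_max).
  exact/(norm_radical_conj O_max)/(different_radical a_neq0 b_neq0 O_max).
by rewrite -scalerAr mulrA quat_normE Nw mulr_algl scalerA mulVf // scale1r.
Qed.

(** For [D = 1] the dual of [O] is contained in [O], so the short dual vector would have a positive
    integral norm below 1. *)
Lemma reduced_disc_neq1 : D <> 1%N.
Proof.
move=> D1; have [y [y0 _ ty Ny]] := exists_small_dual a_lt0 b_lt0 O_order.
have [Oy _] := dual_different a_neq0 b_neq0 O_max ty.
rewrite D1 scale1r in Oy.
have N0 := quat_norm_gt0 a_lt0 b_lt0 y0.
have := norm_intr_ge1 (order_norm_int O_order Oy) (lt0r_neq0 N0).
by rewrite gtr0_norm //; lra.
Qed.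

(** [2 y] lies in the different, so [N (2 y) / 2 = 2 N y] is a positive integer at most [32 / 27],
    hence 1. *)
Lemma pure_norm_two : D = 2%N ->
  exists2 x, O x & quat_trace x = 0 /\ quat_norm x = 2.
Proof.
move=> D2; have [y [y0 y_pure ty Ny]] := exists_small_dual a_lt0 b_lt0 O_order.
have [Oy N2] := dual_different a_neq0 b_neq0 O_max ty.
rewrite D2 in Oy N2; exists (2%:R *: y) => //; split; first by rewrite quat_traceZ y_pure mulr0.
have N0 := quat_norm_gt0 a_lt0 b_lt0 y0.
move: N2; rewrite quat_normZ => /intrP[m mE].
have {}mE : 2 * quat_norm y = m%:~R by rewrite -mE; field.
have m1 : m = 1.
  have : 0 < (m%:~R : rat) by rewrite -mE mulr_gt0.
  have : (m%:~R : rat) < 2%:~R by rewrite -mE; lra.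
  by rewrite ltr0z ltr_int => ? ?; lia.
by move: mE; rewrite m1 => mE; lra.
Qed.

Lemma different_trace x : P x -> quat_trace x / D%:R \is a Num.int.
Proof.
move=> Px; have Ox : O x by case: Px.
apply: (int_div_reduced_disc a_neq0 b_neq0 O_max).
  exact: (order_trace_int O_order).
move=> p pP pD; apply: (norm_radical_trace O_max).
exact: (different_radical a_neq0 b_neq0 O_max).
Qed.

Lemma exists_sqr_of_norm x : O x -> quat_norm x = D%:R ->
  exists2 y, O y & y ^+ 2 = - D%:R.
Proof.
move=> Ox Nx; have Dr : (D%:R : rat) != 0 by rewrite pnatr_eq0 -lt0n.
have pure y : O y -> quat_trace y = 0 -> quat_norm y = D%:R ->
    exists2 y, O y & y ^+ 2 = - D%:R.
  by move=> Oy ty Ny; exists y; rewrite // sqr_pure // Ny scaler_nat.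
have /intrP[s sE] := different_trace (different_norm Ox Nx).
have tE : quat_trace x = D%:R * s%:~R by rewrite -sE mulrC mulfVK.
have [s0|s0] := eqVneq s 0; first by apply: (pure x); rewrite // tE s0 mulr0.
have NE : quat_norm (2 *: x - (quat_trace x)%:A) = 4 * quat_norm x - quat_trace x ^+ 2.
  by quat_ring.
have := quat_norm_ge0 a_lt0 b_lt0 (2 *: x - (quat_trace x)%:A).
rewrite NE Nx tE exprMn => h.
have Ds : (D * `|s| ^ 2 <= 4)%N.
  move: h; rewrite subr_ge0 expr2 -mulrA [4 * _]mulrC ler_pM2l ?ltr0n //.
  rewrite -(ler_nat rat) natrM natrX natr_absz.
  rewrite (_ : `|s|%:~R ^+ 2 = s%:~R ^+ 2 :> rat) //.
  by rewrite intr_norm real_normK ?num_real.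
have s1 : (0 < `|s|)%N by rewrite absz_gt0.
have D4 : (D <= 4)%N by apply: leq_trans Ds; rewrite leq_pmulr // expn_gt0 s1.
have := reduced_disc_squarefree a_neq0 b_neq0 O_max (isT : prime 2).
have := reduced_disc_neq1; move: D_gt0 pure_norm_two Ds.
(* Only 2 and 3 survive: 4 is not squarefree. For 2 the given [x] is abandoned for the pure element
   of norm 2; for 3 the trace is 3 or -3, and [2 x - t] has norm [12 - 9]. *)
case: D D4 Dr Nx tE h pure => [|[|[|[|[|//]]]]] //= _ Dr Nx tE h pure _ two Ds _ _.
- by have [y Oy [ty Ny]] := two erefl; exists y; rewrite // sqr_pure // Ny scaler_nat.
- have ss : (s%:~R : rat) ^+ 2 = 1.
    have : (`|s| = 1)%N by case: `|s|%N s1 Ds => [//|[//|n]] _; rewrite expnS expn1; lia.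
    by move=> sn; rewrite -[LHS]real_normK ?num_real // -intr_norm -natr_absz sn expr1n.
  apply: (pure (2 *: x - (quat_trace x)%:A)).
  + apply: (orderB O_order); apply: (orderZ O_order) => //.
      exact: (order_trace_int O_order).
    exact: (order1 O_order).
  + by rewrite /quat_trace; quat_ring.
  + by rewrite NE Nx tE exprMn ss; ring.
Qed.

(** With a nonzero trace, the quadratic equation of [x] would make [x] rational, with a negative
    square. *)
Lemma pure_of_sqr x : x ^+ 2 = - D%:R -> quat_trace x = 0 /\ quat_norm x = D%:R.
Proof.
rewrite expr2 quat_sqr -[D%:R in X in X -> _]scaler_nat => e.
have e1 : quat_trace x *: x = (quat_norm x - D%:R)%:A.
  by rewrite scalerBl -e addrC subrK.
have scal (r s : rat) : (r%:A : quat a b) = s%:A -> r = s.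
  by move=> /(congr1 (fun z => quat0 z)) /=; rewrite !mulr1.
have t0 : quat_trace x = 0.
  apply/eqP; apply: contraT => t0.
  have xE : x = ((quat_norm x - D%:R) / quat_trace x)%:A.
    by rewrite mulrC -scalerA -e1 scalerA mulVf // scale1r.
  set c := (_ / _) in xE.
  have : c ^+ 2 = - D%:R.
    apply: scal; move: e; rewrite -quat_sqr xE scaleNr => <-.
    by quat_ring.
  move=> c2; have := sqr_ge0 c; rewrite c2 oppr_ge0 lern0.
  by rewrite eqn0Ngt D_gt0.
split=> //; apply: scal; move: e; rewrite t0 scale0r sub0r => /oppr_inj; exact.
Qed.

Lemma different_dot x y : P x -> O y -> quat_dot x y / D%:R \is a Num.int.
Proof.
move=> Px Oy; have [Ox _] := Px.
have [_ _ PM] := different_right_ideal a_neq0 b_neq0 O_max.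
rewrite quat_dotE; apply: different_trace; apply: PM => //.
exact: (order_conj O_order).
Qed.
End Different.

(** * Roots of the lattice [M(O)] *)

Section MLattice.
Variables (R : realType) (a b : rat) (O : set (quat a b)).
Local Notation D := (reduced_disc a b).
Hypothesis D_gt0 : (0 < D)%N.

Let char0 (m : int) : (m%:~R == 0 :> R) = (m == 0). Proof. exact: intr_eq0. Qed.
Let sqrD : Num.sqrt (D%:R : R) ^+ 2 = D%:R. Proof. by rewrite sqr_sqrtr ?ler0n. Qed.
Let Dr : (D%:R : R) != 0. Proof. by rewrite pnatr_eq0 -lt0n. Qed.

(** The root is [x / sqrt D], written as [sqrt D * (x / D)] to fit [M_lattice]; the congruences on
    [x] say that [x / D] is in the dual. *)
Lemma M_order_root x : trace0 O x -> quat_dot x x = (2 * D)%:R ->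
  (forall y, trace0 O y -> quat_dot x y / D%:R \is a Num.int) ->
  exists2 z, M_order R O z & quat_dot z z = 2.
Proof.
move=> Lx xx xL; pose z : quat_over a b R := (D%:R)^-1 *: quat_incl R x.
have zz : quat_dot z z = 2 / D%:R.
  rewrite quat_dotZ quat_dot_incl // xx ratr_nat natrM; by field.
exists (Num.sqrt (D%:R : R) *: z); last by rewrite quat_dotZ sqrD zz mulrC divfK.
exists z => //; split.
- by exists x => //; rewrite /z scalerA divff // scale1r.
- split=> [|_ [y Ly <-]].
    rewrite /= quat_traceZ (_ : quat_trace (quat_incl R x) = 0) ?mulr0 //.
    case: Lx => _; rewrite /quat_trace /= => /eqP; rewrite mulrn_eq0 /= => /eqP ->.
    by rewrite (ratr_nat _ 0) mul0rn.
  have -> : quat_dot z (quat_incl R y) = ratr (quat_dot x y / D%:R).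
    rewrite quat_dotC quat_dotZr quat_dot_incl // quat_dotC fmorph_div /= ratr_nat.
    by rewrite mulrC.
  by have /intrP[m ->] := xL y Ly; rewrite ratr_int intr_int.
- by rewrite zz [D%:R * _]mulrC divfK // divff ?rpred1 ?pnatr_eq0.
Qed.

Lemma norm_of_M_order_root z : M_order R O z -> quat_dot z z = 2 ->
  exists2 x, O x & quat_norm x = D%:R.
Proof.
move=> [y [[x [Ox _] xE] _ _] <-]; rewrite quat_dotZ sqrD => yy.
exists x => //; apply: (fmorph_inj (ratr : rat -> R)).
have : quat_dot (quat_incl R x) (quat_incl R x) = D%:R * 2.
  by rewrite xE quat_dotZ expr2 -mulrA yy.
rewrite quat_dot_incl // quat_dotxx rmorphMn /= ratr_nat => h.
by lra.
Qed.
End MLattice.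

Theorem mainTheorem5 (R : realType) (a b : rat) (a_neq0 : a != 0)
    (b_neq0 : b != 0) (A_definite : definite R a b)
    (O : set (quat a b)) (O_max : is_maximal_order O) :
  let D := reduced_disc a b in
  [<-> exists2 I, is_different O I & principal_right O I;
       exists2 x, O x & quat_norm x = D%:R;
       exists2 x, O x & x ^+ 2 = - D%:R;
       exists x, [/\ trace0 O x, quat_dot x x = (2 * D)%:R &
                     forall y, trace0 O y -> quat_dot x y / D%:R \is a Num.int];
       exists2 x, M_order R O x & quat_dot x x = 2].
Proof.
have [a_lt0 b_lt0] := definite_neg a_neq0 b_neq0 A_definite.
have D_gt0 := reduced_disc_gt0 a_neq0 b_neq0 O_max.
have O_order : is_order O := proj1 O_max.
move=> D; tfae.
- move=> [I [[rI cI] _] [pi Opi eI]]; exists pi => //.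
  apply: (principal_different_norm a_lt0 b_lt0 O_max Opi); rewrite -eI.
  have zI : zmod_closed (mem I) by case: rI.
  apply/esym/(right_ideal_different a_neq0 b_neq0 O_max rI).
  by apply/has_index_card => //; apply: order0.
- by move=> [x Ox Nx]; apply: exists_sqr_of_norm Ox Nx.
- move=> [x Ox xx]; have [tx Nx] := pure_of_sqr a_lt0 b_lt0 O_max xx.
  exists x; split=> // [|y [Oy _]].
    by rewrite quat_dotxx Nx natrM mulr_natl.
  apply: (different_dot a_lt0 b_lt0 O_max _ Oy).
  exact: (different_norm a_lt0 b_lt0 O_max Ox Nx).
- by move=> [x [Lx xx xL]]; apply: M_order_root Lx xx xL.
(* A root is [sqrt D * y] with [D y] in [O], and [D y] has norm [D]; the cycle closes because such
   an element generates the different. *)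
- move=> [z Mz zz]; have [w Ow Nw] := norm_of_M_order_root Mz zz.
  exists (different_set O); first exact: different_unique.
  by exists w => //; apply: norm_different_principal.
Qed.
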